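(* Let $f\in\mathbb{R}[\mathbf{x}]$ and let $\mathbf{g}=(\mathbf{g}^0;\mathbf{g}^+)\subset\mathbb{R}[\mathbf{x}]$ be a set of constraints such that the real variety $\mathcal{V}^{\mathbb{R}}(\mathbf{g}^0)=\{\mathbf{x}\in\mathbb{R}^n:g(\mathbf{x})=0\ \forall g\in\mathbf{g}^0\}$ is finite and $\mathcal{S}(\mathbf{g})\neq\emptyset$. Then there exists $t_0\in\mathbb{N}$ such that for all $t\ge t_0$: (1) $f^{sos}_{t,\mathbf{g}}=f^\mu_{t,\mathbf{g}}=f^*=\min_{\mathbf{x}\in\mathcal{S}(\mathbf{g})}f(\mathbf{x})$ is reached for some $\Lambda^*\in\mathcal{L}_t(\mathbf{g})$; (2) for all $\Lambda^*\in\mathcal{L}_t(\mathbf{g})$ optimal for $f$, $\ker M^t_{\Lambda^*}$ generates $I_{min}$.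
   Context: $\mathbf{x}=(x_1,\dots,x_n)$; $\mathbb{R}[\mathbf{x}]_k$ is the space of polynomials of degree $\le k$ ($\{0\}$ if $k<0$). $\mathbf{g}^0=\{g_1^0,\dots,g_{n_1}^0\}$ (equality constraints) and $\mathbf{g}^+=\{g_1^+,\dots,g_{n_2}^+\}$ (non-negativity constraints) are finite subsets of $\mathbb{R}[\mathbf{x}]$; $\mathcal{S}(\mathbf{g})=\{\mathbf{x}\in\mathbb{R}^n:g_i^0(\mathbf{x})=0\ \forall i,\ g_j^+(\mathbf{x})\ge0\ \forall j\}$. $\mathcal{Q}_t^+$ is the set of finite sums of squares of polynomials of degree $\le t$ ($\{0\}$ if $t<0$). For $\epsilon\in\{0,1\}^{n_2}$ let $g^\epsilon=(g_1^+)^{\epsilon_1}\cdots(g_{n_2}^+)^{\epsilon_{n_2}}$. The truncated preordering is $\mathcal{P}_t(\mathbf{g})=\{\sum_i g_i^0h_i+\sum_{\epsilon}g^\epsilon s_\epsilon: h_i\in\mathbb{R}[\mathbf{x}]_{2t-\deg g_i^0},\ s_\epsilon\in\mathcal{Q}^+_{t-\lceil\deg(g^\epsilon)/2\rceil}\}$. $\mathcal{L}_t(\mathbf{g})=\{\Lambda\in(\mathbb{R}[\mathbf{x}]_{2t})^*:\Lambda(p)\ge0\ \forall p\in\mathcal{P}_t(\mathbf{g}),\ \Lambda(1)=1\}$. $f^\mu_{t,\mathbf{g}}=\inf\{\Lambda(f):\Lambda\in\mathcal{L}_t(\mathbf{g})\}$; $f^{sos}_{t,\mathbf{g}}=\sup\{\gamma\in\mathbb{R}:f-\gamma\in\mathcal{P}_t(\mathbf{g})\}$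 ($-\infty$ if no such $\gamma$). For $\Lambda\in(\mathbb{R}[\mathbf{x}]_{2t})^*$, $M^t_\Lambda:\mathbb{R}[\mathbf{x}]_t\to(\mathbb{R}[\mathbf{x}]_t)^*$ is $M^t_\Lambda(p)(q)=\Lambda(pq)$. $\Lambda^*\in\mathcal{L}_t(\mathbf{g})$ is optimal for $f$ if $\Lambda^*(f)=f^\mu_{t,\mathbf{g}}$ and $\operatorname{rank}M^t_{\Lambda^*}$ is maximal among all $\Lambda\in\mathcal{L}_t(\mathbf{g})$ with $\Lambda(f)=f^\mu_{t,\mathbf{g}}$ (equivalently, $\ker M^t_{\Lambda^*}\subset\ker M^t_\Lambda$ for all such $\Lambda$). $I_{min}\subset\mathbb{R}[\mathbf{x}]$ is the vanishing ideal of the set of minimizers $\{\mathbf{x}^*\in\mathcal{S}(\mathbf{g}):f(\mathbf{x}^* )=\min_{\mathcal{S}(\mathbf{g})}f\}$. *)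

(* Defs.v *)
From HB Require Import structures.
From mathcomp Require Import all_boot all_order all_algebra.
From mathcomp Require Import mpoly.
From mathcomp Require Import boolp classical_sets functions cardinality.
From mathcomp Require Import reals constructive_ereal ereal.

Set Implicit Arguments.
Unset Strict Implicit.
Unset Printing Implicit Defensive.

Import Order.TTheory GRing.Theory Num.Theory.
Local Open Scope ring_scope.
Local Open Scope classical_set_scope.

(* [msize p] is the degree plus one, and [msize 0 = 0]. *)
Definition mpdeg (n : nat) (R : nzRingType) (p : {mpoly R[n]}) : nat :=
  (msize p).-1.

(* [msize p <= deg_bound k] means deg p <= k when k >= 0, and p = 0 when
   k < 0. *)
Definition deg_bound (k : int) : nat := if k is Posz d then d.+1 else 0%N.

Definition deg_le (n : nat) (R : nzRingType) (k : int) : {pred {mpoly R[n]}} :=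
  fun p => (msize p <= deg_bound k)%N.
Arguments deg_le {n R} k _ /.

Lemma deg_le_submod_closed (n : nat) (R : nzRingType) (k : int) :
  submod_closed (@deg_le n R k).
Proof.
split=> [|c p q]; rewrite !unfold_in; first by rewrite msize0.
move=> hp hq; apply: (leq_trans (msizeD_le _ _)); rewrite geq_max hq andbT.
exact: leq_trans (msizeZ_le _ _) hp.
Qed.

HB.instance Definition _ (n : nat) (R : nzRingType) (k : int) :=
  GRing.isSubmodClosed.Build R {mpoly R[n]} (@deg_le n R k)
    (@deg_le_submod_closed n R k).

(* The space R[x]_k, as a finite-dimensional vector space. *)
Record polyle (n : nat) (R : nzRingType) (k : int) := PolyLe {
  mpoly_of_polyle :> {mpoly R[n]};
  polyleP : mpoly_of_polyle \in deg_le k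
}.

HB.instance Definition _ (n : nat) (R : nzRingType) (k : int) :=
  [isSub for @mpoly_of_polyle n R k].
HB.instance Definition _ (n : nat) (R : nzRingType) (k : int) :=
  [Choice of polyle n R k by <:].
HB.instance Definition _ (n : nat) (R : nzRingType) (k : int) :=
  [SubChoice_isSubLmodule of polyle n R k by <:].

Lemma polyle_vecaxiom (n : nat) (R : nzRingType) (k : int) :
  Vector.axiom #|{: 'X_{1..n < deg_bound k}}| (polyle n R k).
Proof.
set b := deg_bound k.
pose f (p : polyle n R k) :=
  \row_(i < #|{: 'X_{1..n < b}}|) (val p)@_(val (enum_val i)).
exists f => [c p q|].
  by apply/rowP=> i; rewrite !mxE /= mcoeffD mcoeffZ.
pose g (r : 'rV[R]_(#|{: 'X_{1..n < b}}|)) : {mpoly R[n]} :=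
  \sum_(m : 'X_{1..n < b}) r 0 (enum_rank m) *: 'X_[val m].
have gP r : g r \in deg_le k.
  apply: rpred_sum => m _; apply: rpredZ.
  by rewrite unfold_in msizeX; case: m.
exists (fun r => PolyLe (gP r)) => [p|r].
  apply/val_inj => /=; rewrite /g [RHS](mpolywE (polyleP p)).
  by apply: eq_bigr => m _; rewrite mxE enum_rankK.
apply/rowP => i; rewrite mxE /= /g.
pose E m := oapp (fun m' : 'X_{1..n < b} => r 0 (enum_rank m')) 0 (insub m).
have -> : \sum_(m : 'X_{1..n < b}) r 0 (enum_rank m) *: 'X_[val m] =
          \sum_(m : 'X_{1..n < b}) E (val m) *: 'X_[val m].
  by apply: eq_bigr => m _; rewrite /E valK.
rewrite (@mcoeff_mpoly n R E _ b (bmdeg _)) /E valK.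
by rewrite [oapp _ _ _]/= enum_valK.
Qed.

HB.instance Definition _ (n : nat) (R : nzRingType) (k : int) :=
  Lmodule_hasFinDim.Build R (polyle n R k) (@polyle_vecaxiom n R k).

Lemma polyle1P (n : nat) (R : nzRingType) (t : nat) :
  (1 : {mpoly R[n]}) \in deg_le (2 * t)%N.
Proof. by rewrite unfold_in msize1. Qed.

Definition polyle1 (n : nat) (R : nzRingType) (t : nat) :
  polyle n R (2 * t)%N := PolyLe (polyle1P n R t).

Lemma polyle_mulP (n : nat) (R : idomainType) (t : nat) (p q : polyle n R t) :
  (p : {mpoly R[n]}) * q \in deg_le (2 * t)%N.
Proof.
rewrite unfold_in; have [->|p0] := eqVneq (p : {mpoly R[n]}) 0.
  by rewrite mul0r msize0.
have [->|q0] := eqVneq (q : {mpoly R[n]}) 0; first by rewrite mulr0 msize0.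
rewrite msizeM // -subn1 leq_subLR.
apply: leq_trans (leq_add (polyleP p) (polyleP q)) _.
by rewrite /= mul2n -addnn addSn addnS.
Qed.

Definition polyle_mul (n : nat) (R : idomainType) (t : nat)
  (p q : polyle n R t) : polyle n R (2 * t)%N := PolyLe (polyle_mulP p q).

(* The dual space (R[x]_2t)^*. *)
Notation polydual n R t := ('Hom(polyle n R (Posz (2 * t)%N), R^o)).

Definition moment_map (R : realType) (n t : nat) (L : polydual n R t) :
    'Hom(polyle n R t, 'Hom(polyle n R t, R^o)) :=
  linfun (fun p : polyle n R t =>
    linfun (fun q : polyle n R t => L (polyle_mul p q) : R^o)).

(* [linfun] is only meaningful on linear maps: both occurrences above are. *)
Lemma moment_mapE (R : realType) (n t : nat) (L : polydual n R t)
  (p q : polyle n R t) : moment_map L p q = L (polyle_mul p q).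
Proof.
have lin2 (p' : polyle n R t) :
    linear (fun q : polyle n R t => L (polyle_mul p' q) : R^o).
  move=> c q1 q2; rewrite -linearP; congr (L _); apply/val_inj => /=.
  by rewrite mulrDr scalerAr.
pose F2 p' := HB.pack_for {linear polyle n R t -> R^o}
  (fun q : polyle n R t => L (polyle_mul p' q) : R^o)
  (GRing.isLinear.Build R _ _ _ _ (lin2 p')).
have E2 p' q' : linfun (fun q : polyle n R t => L (polyle_mul p' q) : R^o) q'
    = L (polyle_mul p' q') by exact: (lfunE (F2 p')).
have lin1 : linear (fun p : polyle n R t =>
    linfun (fun q : polyle n R t => L (polyle_mul p q) : R^o)).
  move=> c p1 p2; apply/lfunP => q'; rewrite lfunE/= lfunE/= !E2.
  rewrite -linearP; congr (L _); apply/val_inj => /=.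
  by rewrite mulrDl scalerAl.
pose F1 := HB.pack_for {linear polyle n R t -> 'Hom(polyle n R t, R^o)}
  (fun p : polyle n R t =>
    linfun (fun q : polyle n R t => L (polyle_mul p q) : R^o))
  (GRing.isLinear.Build R _ _ _ _ lin1).
by rewrite -E2 /moment_map; congr (fun_of_lfun _ _); exact: (lfunE F1).
Qed.

Section Relaxation.
Context (R : realType) (n n1 n2 : nat).
Context (g0 : 'I_n1 -> {mpoly R[n]}) (gp : 'I_n2 -> {mpoly R[n]}).

Definition real_variety : set ('I_n -> R) :=
  [set x | forall i, (g0 i).@[x] = 0].

Definition feasible_set : set ('I_n -> R) :=
  [set x | (forall i, (g0 i).@[x] = 0) /\ (forall j, 0 <= (gp j).@[x])].

Definition sos_le (k : int) : set {mpoly R[n]} :=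
  [set q | exists2 s : seq {mpoly R[n]},
     {subset s <= deg_le k} & q = \sum_(p <- s) p ^+ 2].

Definition gprod (e : {ffun 'I_n2 -> bool}) : {mpoly R[n]} :=
  \prod_(j < n2) gp j ^+ e j.

Definition truncated_preordering (t : nat) : set {mpoly R[n]} :=
  [set p | exists (h : 'I_n1 -> {mpoly R[n]})
                  (s : {ffun 'I_n2 -> bool} -> {mpoly R[n]}),
     [/\ forall i, h i \in deg_le ((2 * t)%N%:Z - (mpdeg (g0 i))%:Z),
         forall e, sos_le (t%:Z - (uphalf (mpdeg (gprod e)))%:Z) (s e)
       & p = \sum_(i < n1) g0 i * h i + \sum_e gprod e * s e]].

Definition feasible_form (t : nat) : set (polydual n R t) :=
  [set L | (forall p : polyle n R (2 * t)%N,
              truncated_preordering t p -> 0 <= (L p : R))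
           /\ L (polyle1 n R t) = 1].
Arguments feasible_form t : clear implicits.

Local Open Scope ereal_scope.

Definition f_mu (t : nat) (f : polyle n R (2 * t)%N) : \bar R :=
  ereal_inf [set (L f : R)%:E | L in feasible_form t].

Definition f_sos (t : nat) (f : {mpoly R[n]}) : \bar R :=
  ereal_sup [set c%:E | c in
    [set c : R | truncated_preordering t (f - c%:MP)%R]].

Definition f_star (f : {mpoly R[n]}) : \bar R :=
  ereal_inf [set (f.@[x])%:E | x in feasible_set].

Definition minimizers (f : {mpoly R[n]}) : set ('I_n -> R) :=
  [set x | feasible_set x /\ (f.@[x])%:E = f_star f].

Definition optimal_form (t : nat) (f : polyle n R (2 * t)%N) :
    set (polydual n R t) :=
  [set L | [/\ feasible_form t L,
               (L f : R)%:E = f_mu f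
             & forall L', feasible_form t L' ->
                 (L' f : R)%:E = f_mu f ->
                 (\dim (limg (moment_map L')) <=
                  \dim (limg (moment_map L)))%N]].

Definition moment_ker (t : nat) (L : polydual n R t) : set {mpoly R[n]} :=
  [set (p : {mpoly R[n]}) | p in
    [set p : polyle n R t | p \in lker (moment_map L)]].

Definition generated_ideal (A : set {mpoly R[n]}) : set {mpoly R[n]} :=
  [set p | exists2 s : seq ({mpoly R[n]} * {mpoly R[n]}),
     (forall u, u \in s -> A u.2) & p = (\sum_(u <- s) u.1 * u.2)%R].

Definition vanishing_ideal (V : set ('I_n -> R)) : set {mpoly R[n]} :=
  [set p | forall x, V x -> p.@[x] = 0%R].

End Relaxation.

Arguments feasible_form {R n n1 n2} g0 gp t _.

(* Main.v *)
Require Import Defs.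
From HB Require Import structures.
From mathcomp Require Import generic_quotient ring_quotient fraction closed_field.
From mathcomp Require Import polyorder polyrcf qe_rcf_th.
From mathcomp Require Import ring lra zify.
From mathcomp Require Import all_boot all_order all_algebra.
From mathcomp Require Import mpoly.
From mathcomp Require Import boolp classical_sets functions cardinality.
From mathcomp Require Import reals constructive_ereal ereal.

(** Everything rests on one approximation statement,
[nonneg_uniformly_preordered]: when the real variety of g0 is finite and p is
nonnegative on S(g), there is an order t0 such that p + eps lies in P_t(g) for
every t >= t0 and every eps > 0. The point is that t0 does not depend on eps.
One cannot ask for p itself, because P_t(g) need not be closed: with the single
equation x^2 = 0, the polynomial x + eps is a square plus a multiple of x^2 for
every eps > 0, while x is not.

Granting this, let fmin be the minimum of f over S(g). Part (1) follows by
taking p = f - fmin: it gives Lambda(f) >= fmin for every feasible Lambda and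
f_sos >= fmin, and evaluation at a minimizer gives
the opposite inequalities and a form that attains the value. For part (2), let
h run over a finite generating set of I_min
([vanishing_ideal_finite_generators]). On the finite set S(g) the function
f - fmin vanishes only at the minimizers, where h vanishes too, so
C (f - fmin) - h^2 >= 0 on S(g) for some constant C; an optimal Lambda then has
Lambda(h^2) <= C (Lambda(f) - fmin) = 0, and h belongs to the kernel of the moment
map by the Cauchy-Schwarz inequality ([moment_ker_sqr]). Conversely, averaging
an optimal form of maximal rank with the evaluation at a minimizer shows that
its kernel lies in the kernel of that evaluation ([optimal_ker_sub]), so
every polynomial in it vanishes at the minimizer.

To prove the approximation statement, interpolate p at the points of the finite
real variety by an element sigma of the preordering. The remainder q = p - sigma
vanishes on the real variety, so -q^(2m) is a sum of squares modulo g0 for some m,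
by the real Nullstellensatz ([real_nullstellensatz]). By repeatedly completing
squares, eps + q + c q^(2^k) is a sum of squares whose degrees do not
depend on eps; only the constant c does ([complete_square_iter]). The error term
c q^(2^k) is paid for by the Nullstellensatz.

For the real Nullstellensatz, suppose that no -q^(2m) is a sum of squares modulo
g0. Zorn's lemma ([maximal_preorder]) extends this cone to a total one whose
support is a prime ideal that contains g0 and misses q. It remains to turn the
resulting ordering into a point of R^n.

First, the ordering is realized in a real closed field L
([real_closed_realization]). Only finitely many coefficients matter, so the
ordering can be restricted to the countable ring of integer polynomials in the
coefficients and the variables; its residue field embeds in an algebraically
closed field C, and a maximal ordered subfield of C is real closed. This
gives a point with coordinates in L at which g0 vanishes and q does not.

Second, sign conditions are transferred from L to R one variable at a time
([sign_transfer]). The number of roots of a polynomial at which given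
polynomials have given signs is computed from Cauchy indices, hence by
Euclid's algorithm, hence from the signs of finitely many polynomial
expressions in the coefficients. If these signs agree in L and R, so do the
counts, and a root in L forces one in R. *)

Set Implicit Arguments.
Unset Strict Implicit.
Unset Printing Implicit Defensive.

Import Order.TTheory GRing.Theory Num.Theory.
Local Open Scope ring_scope.
Local Open Scope classical_set_scope.

(** * Preorderings of a commutative ring *)

(** Zorn's lemma for families of sets, above a given member: the union of the
empty chain need not belong to the family, so only nonempty chains are asked to
have their union in it. *)
Lemma Zorn_above (T : Type) (P : set (set T)) (A0 : set T) : P A0 ->
  (forall F : set (set T), F !=set0 -> F `<=` P -> total_on F subset ->
     P (\bigcup_(X in F) X)) ->
  exists A, [/\ P A, A0 `<=` A & forall B, P B -> A `<=` B -> B `<=` A].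
Proof.
move=> PA0 chainP.
have [|A [PA Amax]] := @Zorn_bigcup T [set A | P (A0 `|` A)].
  move=> F FP Ftot; have [[X0 FX0]|F0] := pselect (F !=set0); last first.
    have -> : \bigcup_(X in F) X = set0.
      by apply/seteqP; split=> // x [X FX _]; apply: F0; exists X.
    by rewrite /= setU0.
  rewrite /=; have -> : A0 `|` \bigcup_(X in F) X =
    \bigcup_(Y in [set A0 `|` X | X in F]) Y.
    rewrite bigcup_image; apply/seteqP; split=> [x [A0x|[X FX Xx]]|x [X FX]].
    - by exists X0 => //; left.
    - by exists X => //; right.
    - by case=> [|Xx]; [left|right; exists X].
  apply: chainP; first by exists (A0 `|` X0), X0.
    by move=> _ [X FX <-]; exact: FP.
  move=> _ _ [X FX <-] [Y FY <-].
  by case: (Ftot X Y FX FY) => ?; [left|right]; exact: setUS.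
exists (A0 `|` A); split=> // B PB AB x Bx; apply: contrapT => nAx.
apply: (Amax (A0 `|` B)); last by rewrite /= setUA setUid setUidr //; exact: subset_trans AB; exact: subsetUl.
split=> [|AB']; first by move=> y Ay; right; apply: AB; right.
by apply: nAx; right; apply: AB'; right.
Qed.

Definition preorder (A : comNzRingType) (T : set A) :=
  [/\ forall x y, T x -> T y -> T (x + y),
      forall x y, T x -> T y -> T (x * y)
    & forall x, T (x ^+ 2)].

Definition support (A : comNzRingType) (T : set A) : set A :=
  [set x | T x /\ T (- x)].

(** A point of the real spectrum: an ordering of the quotient of the ring by the
prime ideal [support T]. *)
Record prime_cone (A : comNzRingType) (T : set A) := PrimeCone {
  prime_cone_preorder : preorder T;
  prime_cone_total : forall x, T x \/ T (- x);
  prime_coneN1 : ~ T (-1);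
  prime_cone_prime : forall x y,
    support T (x * y) -> support T x \/ support T y
}.

Section Preorders.
Variables (A : comNzRingType).
Implicit Types (T : set A) (x y : A).

Lemma preorderD T x y : preorder T -> T x -> T y -> T (x + y).
Proof. by case=> H _ _; exact: H. Qed.

Lemma preorderM T x y : preorder T -> T x -> T y -> T (x * y).
Proof. by case=> _ H _; exact: H. Qed.

Lemma preorder_sqr T x : preorder T -> T (x ^+ 2).
Proof. by case. Qed.

Lemma preorder0 T : preorder T -> T 0.
Proof. by move=> pT; rewrite -[0](expr0n _ 2); exact: preorder_sqr. Qed.

Lemma preorder1 T : preorder T -> T 1.
Proof. by move=> pT; rewrite -[1](expr1n _ 2); exact: preorder_sqr. Qed.

Lemma supportM T x y : preorder T -> support T x -> T y -> support T (x * y).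
Proof.
move=> pT [Tx TNx] Ty; split; first exact: preorderM.
by rewrite -mulNr; exact: preorderM.
Qed.

Definition adjoin T x : set A := [set a | exists u v, [/\ T u, T v & a = u + v * x]].

Lemma subset_adjoin T x : preorder T -> T `<=` adjoin T x.
Proof.
move=> pT u Tu; exists u, 0; split=> //; first exact: preorder0.
by rewrite mul0r addr0.
Qed.

Lemma adjoin_mem T x : preorder T -> adjoin T x x.
Proof.
move=> pT; exists 0, 1; split; [exact: preorder0|exact: preorder1|].
by rewrite mul1r add0r.
Qed.

Lemma adjoin_preorder T x : preorder T -> preorder (adjoin T x).
Proof.
move=> pT; have [TD TM Tsq] := pT; split.
- move=> _ _ [u [v [Tu Tv ->]]] [u' [v' [Tu' Tv' ->]]].
  by exists (u + u'), (v + v'); split; [exact: TD|exact: TD|ring].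
- move=> _ _ [u [v [Tu Tv ->]]] [u' [v' [Tu' Tv' ->]]].
  exists (u * u' + v * v' * x ^+ 2), (u * v' + v * u'); split; last by ring.
    by apply: TD; [exact: TM|apply: (TM) => //; exact: (TM)].
  by apply: TD; exact: TM.
- by move=> y; apply: subset_adjoin.
Qed.

(** A preordering that avoids -M, for a multiplicative set M, is contained in a
prime cone that still avoids -M. If T is maximal and contains neither x nor -x,
then m + u = - v x and m' + u' = v' x for some m, m' in M, and multiplying the
two identities puts - m m' in T. Primality of the support follows in the same
way. With M = {1} this produces orderings; with M the even powers of q it produces
orderings in which q does not become zero. *)
Lemma maximal_preorder T0 (M : set A) :
  preorder T0 -> M 1 -> (forall x y, M x -> M y -> M (x * y)) ->
  M `<=` T0 -> (forall m, M m -> ~ T0 (- m)) ->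
  exists T, [/\ T0 `<=` T, prime_cone T & forall m, M m -> ~ T (- m)].
Proof.
move=> pT0 M1 MM MT0 M0.
pose P := [set T : set A | preorder T /\ forall m, M m -> ~ T (- m)].
have [||T [[pT MT] T0T Tmax]] := @Zorn_above _ P T0.
- by split.
- move=> F [X FX] FP Ftot; split; last first.
    by move=> m Mm [Y FY]; apply: (FP Y FY).2.
  split=> [x y [Y FY Yx] [Z FZ Zy]|x y [Y FY Yx] [Z FZ Zy]|x].
  - case: (Ftot Y Z FY FZ) => [YZ|ZY].
      by exists Z => //; apply: (preorderD (FP Z FZ).1) => //; exact: YZ.
    by exists Y => //; apply: (preorderD (FP Y FY).1) => //; exact: ZY.
  - case: (Ftot Y Z FY FZ) => [YZ|ZY].
      by exists Z => //; apply: (preorderM (FP Z FZ).1) => //; exact: YZ.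
    by exists Y => //; apply: (preorderM (FP Y FY).1) => //; exact: ZY.
  - by exists X => //; exact: (preorder_sqr _ (FP X FX).1).
have TM m : M m -> T m by move=> Mm; apply: T0T; exact: MT0.
have notT x : ~ T x -> exists m u v, [/\ M m, T u, T v & v * x = - (m + u)].
  move=> nTx; apply: contrapT => nex; apply: nTx.
  apply: (Tmax (adjoin T x)); last exact: adjoin_mem.
    split; first exact: adjoin_preorder.
    move=> m Mm [u [v [Tu Tv muv]]]; apply: nex; exists m, u, v; split=> //.
    by rewrite opprD muv; ring.
  exact: subset_adjoin.
have TMN m : M m -> ~ T (- m) by exact: MT.
exists T; split=> //; split=> //.
- move=> x; apply: contrapT => /not_orP[/notT[m [u [v [Mm Tu Tv vx]]]]].
  move=> /notT[m' [u' [v' [Mm' Tu' Tv' vx']]]].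
  apply: (TMN (m * m')); first exact: MM.
  have -> : - (m * m') = m * u' + u * m' + u * u' + v * v' * x ^+ 2.
    have : (v * x) * (v' * - x) = (m + u) * (m' + u') by rewrite vx vx'; ring.
    have -> : v * v' * x ^+ 2 = - ((v * x) * (v' * - x)) by ring.
    by move=> ->; ring.
  apply: (preorderD pT); last first.
    by apply: (preorderM pT); [exact: preorderM|exact: preorder_sqr].
  by apply: (preorderD pT); first apply: (preorderD pT); apply: (preorderM pT) => //; exact: (TM).
- exact: TMN.
- move=> x y [Txy TNxy].
  have key a b : support T (a * b) -> ~ T a -> ~ T b -> False.
    move=> [_ TNab] /notT[m [u [v [Mm Tu Tv va]]]].
    move=> /notT[m' [u' [v' [Mm' Tu' Tv' vb]]]].
    apply: (TMN (m * m')); first exact: MM.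
    have -> : - (m * m') = m * u' + u * m' + u * u' + v * v' * - (a * b).
      have : (v * a) * (v' * b) = (m + u) * (m' + u') by rewrite va vb; ring.
      have -> : v * v' * - (a * b) = - ((v * a) * (v' * b)) by ring.
      by move=> ->; ring.
    apply: (preorderD pT); last by apply: (preorderM pT) => //; exact: preorderM.
    by apply: (preorderD pT); first apply: (preorderD pT); apply: (preorderM pT) => //; exact: (TM).
  apply: contrapT => /not_orP[nx ny].
  have splitN z : ~ support T z -> ~ T z \/ ~ T (- z).
    by move=> nz; apply: contrapT => /not_orP[/contrapT ? /contrapT ?]; apply: nz.
  have sxy : support T (x * y) by [].
  have sNxy : support T (- (x * y)) by split=> //; rewrite opprK.
  case: (splitN _ nx) (splitN _ ny) => hx [] hy.
  - exact: (key x y).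
  - by apply: (key x (- y)) => //; rewrite mulrN.
  - by apply: (key (- x) y) => //; rewrite mulNr.
  - by apply: (key (- x) (- y)) => //; rewrite mulrNN.
Qed.

End Preorders.

(** * Real closed realization of an ordering *)

Section ResidueField.
Local Open Scope quotient_scope.

(** The inverse of a unit is picked by choice, so that an arbitrary commutative
domain acquires the structure needed to form its fraction field. *)
Lemma domain_fraction_field (Q : comNzRingType) :
  (forall x y : Q, x * y = 0 -> x = 0 \/ y = 0) ->
  exists (K : fieldType) (i : {rmorphism Q -> K}),
    (forall x, i x = 0 -> x = 0) /\ forall k, exists a b, i b != 0 /\ k = i a / i b.
Proof.
move=> dom.
pose unitq : pred Q := fun x => `[< exists y, y * x = 1 >].
pose invq (x : Q) := xget x [set y | y * x = 1].
have mulVq : {in unitq, left_inverse 1 invq *%R}.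
  by move=> x /asboolP[y yx]; rewrite /invq; case: xgetP => [z _ ->//|/(_ y)].
have unitPl x y : y * x = 1 -> unitq x by move=> yx; apply/asboolP; exists y.
have invq_out : {in [predC unitq], invq =1 id}.
  move=> x /asboolPn nx; rewrite /invq; case: xgetP => // z _ zx.
  by case: nx; exists z.
have domb (x y : Q) : x * y = 0 -> (x == 0) || (y == 0).
  by move=> /dom[]->; rewrite eqxx ?orbT.
pose QU : comUnitRingType := HB.pack Q (GRing.ComNzRing_hasMulInverse.Build Q mulVq unitPl invq_out).
pose QD : idomainType := HB.pack Q QU (GRing.ComUnitRing_isIntegral.Build QU domb).
exists {fraction QD}, (@FracField.tofrac QD : {rmorphism QD -> {fraction QD}}).
split=> [x /eqP|k]; first by rewrite tofrac_eq0 => /eqP.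
have fracE (r : {ratio QD}) : (\pi_({fraction QD}) r) * FracField.tofrac \d_r = FracField.tofrac \n_r.
  unlock FracField.tofrac; rewrite -[LHS]FracField.pi_mul.
  apply/eqmodP => /=; rewrite /equivf /FracField.mulf.
  by rewrite !numden_Ratio ?(oner_eq0, mul1r, mulr1, denom_ratioP) //= mulrC.
elim/quotW: k => r; exists (\n_r), (\d_r).
have dr0 : FracField.tofrac \d_r != 0 by rewrite tofrac_eq0 denom_ratioP.
by split=> //; apply: (canRL (mulfK dr0)); exact: fracE.
Qed.

Lemma residue_field (A : comNzRingType) (I : prime_idealr A) :
  exists (K : fieldType) (i : {rmorphism A -> K}),
    (forall x, i x = 0 <-> x \in I) /\
    forall k, exists a b, i b != 0 /\ k = i a / i b.
Proof.
pose Q := {ideal_quot I}.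
have [x y /Quotient.rquot_IdomainAxiom /orP[]/eqP-> //|K [i [i_inj iK]]] :=
  @domain_fraction_field Q; [by left|by right|].
exists K, (i \o \pi_Q : {rmorphism A -> K}); split=> [x|k].
  have piE : \pi_Q x = 0 <-> x \in I.
    split=> [/eqP|xI].
      by rewrite -[0](rmorph0 \pi_Q) -Quotient.idealrBE subr0.
    by apply/eqP; rewrite -[0](rmorph0 \pi_Q) -Quotient.idealrBE subr0.
  by rewrite -piE; split=> /= [/i_inj//|->]; rewrite rmorph0.
have [a [b [ib0 ->]]] := iK k.
by exists (repr a), (repr b); rewrite /= !reprK.
Qed.

Definition supportb (A : comNzRingType) (T : set A) : {pred A} :=
  fun x => `[< support T x >].

Lemma cone_residue_field (A : comNzRingType) (T : set A) : prime_cone T ->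
  exists (K : fieldType) (i : {rmorphism A -> K}),
    (forall x, i x = 0 <-> support T x) /\
    forall k, exists a b, i b != 0 /\ k = i a / i b.
Proof.
move=> coneT; have pT := prime_cone_preorder coneT.
have idI : idealr_closed (supportb T).
  split.
  - by apply/asboolP; split; rewrite ?oppr0; exact: preorder0.
  - by apply/asboolPn => -[_]; exact: prime_coneN1.
  - move=> a u v /asboolP su /asboolP [Tv TNv]; apply/asboolP.
    have [Tau TNau] : support T (a * u).
      case: (prime_cone_total coneT a) => Ta; first by rewrite mulrC; exact: supportM.
      have [h1 h2] := supportM pT su Ta.
      by split; rewrite mulrC -?mulrN // -[u * a]opprK -mulrN.
    by split; rewrite ?opprD; exact: preorderD.
have prI : prime_idealr_closed (supportb T).
  by move=> u v /asboolP /(prime_cone_prime coneT)[] ?; apply/orP; [left|right]; apply/asboolP.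
pose I : prime_idealr A := HB.pack (supportb T : A -> bool)
  (isIdealr.Build A _ idI) (isPrimeIdealrClosed.Build A _ prI).
have [K [i [iI iK]]] := residue_field I.
exists K, i; split=> // x; rewrite iI; split=> [/asboolP//|sx]; exact/asboolP.
Qed.

End ResidueField.

Lemma countable_field_closure (K : fieldType) (code : K -> nat) :
  injective code -> exists (C : closedFieldType) (i : {rmorphism K -> C}), True.
Proof.
move=> code_inj; pose decode n := xget 0 [set k | code k = n].
have codeK : cancel code decode.
  move=> k; by rewrite /decode; case: xgetP => [z _ /code_inj //|/(_ k)[]].
pose KC : countFieldType := HB.pack K (CanIsCountable codeK).
have [C [i _]] := countable_algebraic_closure KC.
by exists C, i.
Qed.

Lemma cone_closed_field (A : comNzRingType) (T : set A) (code : A -> nat) :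
  injective code -> prime_cone T ->
  exists (C : closedFieldType) (i : {rmorphism A -> C}),
    forall x, i x = 0 <-> support T x.
Proof.
move=> code_inj /cone_residue_field[K [i [iT iK]]].
have /choice[f fP] : forall k, exists ab : A * A, k = i ab.1 / i ab.2.
  by move=> k; have [a [b [_ ->]]] := iK k; exists (a, b).
have code_inj2 : injective (fun k => pickle (code (f k).1, code (f k).2)).
  move=> k l /(pcan_inj pickleK)[/code_inj e1 /code_inj e2].
  by rewrite (fP k) (fP l) e1 e2.
have [C [j _]] := countable_field_closure code_inj2.
exists C, (j \o i : {rmorphism A -> C}) => x /=.
rewrite -iT; split=> [/eqP|->]; last by rewrite rmorph0.
by rewrite fmorph_eq0 => /eqP.
Qed.

(** P is the set of nonnegative elements of an ordered subfield of C; the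
subfield itself is P together with -P. Ordered subfields are handled through
their cones alone, so that Zorn's lemma applies to sets. *)
Definition is_subfield_cone (C : fieldType) (P : set C) :=
  [/\ forall x y, P x -> P y -> P (x + y),
      forall x y, P x -> P y -> P (x * y),
      forall x, P x -> P x^-1,
      P 1 /\ ~ P (-1)
    & forall x y, P x -> P y -> P (x - y) \/ P (y - x)].

Record subfield_cone (C : fieldType) := SubfieldCone {
  cone_set :> C -> Prop;
  subfield_coneP : is_subfield_cone cone_set
}.

Section ConeField.
Variables (C : fieldType) (P : subfield_cone C).

Lemma coneD (x y : C) : P x -> P y -> P (x + y).
Proof. by have [H _ _ _ _] := subfield_coneP P; exact: H. Qed.

Lemma coneM (x y : C) : P x -> P y -> P (x * y).
Proof. by have [_ H _ _ _] := subfield_coneP P; exact: H. Qed.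

Lemma coneV (x : C) : P x -> P x^-1.
Proof. by have [_ _ H _ _] := subfield_coneP P; exact: H. Qed.

Lemma cone1 : P 1.
Proof. by have [_ _ _ [H _] _] := subfield_coneP P. Qed.

Lemma cone_anti (x : C) : P x -> P (- x) -> x = 0.
Proof.
move=> Px PNx; apply/eqP; apply: contrapT => /negP x0.
have [_ _ _ [_ H] _] := subfield_coneP P; apply: H.
by rewrite -(mulfV x0) -mulNr; apply: coneM => //; exact: coneV.
Qed.

Lemma coneB (x y : C) : P x -> P y -> P (x - y) \/ P (y - x).
Proof. by have [_ _ _ _ H] := subfield_coneP P; exact: H. Qed.

Definition cone_span : {pred C} := fun x => `[< P x \/ P (- x) >].

Lemma cone_spanP x : reflect (P x \/ P (- x)) (x \in cone_span).
Proof. exact: asboolP. Qed.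

Lemma cone_spanN x : x \in cone_span -> - x \in cone_span.
Proof.
by move=> /cone_spanP[?|?]; apply/cone_spanP; [right; rewrite opprK|left].
Qed.

Lemma cone_span_divring : divring_closed cone_span.
Proof.
split; first by apply/cone_spanP; left; exact: cone1.
- have spanD x y : P x -> P y -> x - y \in cone_span.
    by move=> Px Py; apply/cone_spanP; have [?|?] := coneB Px Py;
      [left|right; rewrite opprB].
  move=> x y /cone_spanP[Px|Px] /cone_spanP[Py|Py].
  + exact: spanD.
  + by apply/cone_spanP; left; exact: coneD.
  + rewrite -[x]opprK -opprD; apply: cone_spanN; apply/cone_spanP; left.
    exact: coneD.
  + by rewrite addrC -[x]opprK; exact: spanD.
- have spanM x y : P x -> P y -> x / y \in cone_span.
    by move=> Px Py; apply/cone_spanP; left; apply: coneM => //; exact: coneV.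
  move=> x y /cone_spanP[Px|Px] /cone_spanP[Py|Py].
  + exact: spanM.
  + by rewrite -[y]opprK invrN mulrN; apply: cone_spanN; exact: spanM.
  + by rewrite -[x]opprK mulNr; apply: cone_spanN; exact: spanM.
  + by rewrite -mulrNN -invrN; exact: spanM.
Qed.

HB.instance Definition _ :=
  GRing.isDivringClosed.Build C cone_span cone_span_divring.

Record cone_field := ConeFieldElt {
  cone_field_val : C; cone_field_valP : cone_field_val \in cone_span }.

HB.instance Definition _ := [isSub for cone_field_val].
HB.instance Definition _ := [Choice of cone_field by <:].
HB.instance Definition _ := [SubChoice_isSubIntegralDomain of cone_field by <:].
HB.instance Definition _ := [SubIntegralDomain_isSubField of cone_field by <:].

Implicit Types x y : cone_field.

Definition cone_le x y := `[< P (val y - val x) >].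
Definition cone_norm x := if cone_le 0 x then x else - x.

Lemma cone_le0 x : cone_le 0 x <-> P (val x).
Proof. by rewrite /cone_le rmorph0 subr0; split=> [/asboolP|/asboolP]. Qed.

Lemma cone_le0N x : cone_le x 0 <-> P (- val x).
Proof. by rewrite /cone_le rmorph0 sub0r; split=> [/asboolP|/asboolP]. Qed.

Fact cone_le0_add x y : cone_le 0 x -> cone_le 0 y -> cone_le 0 (x + y).
Proof. by move=> /cone_le0 ? /cone_le0 ?; apply/cone_le0; rewrite rmorphD; exact: coneD. Qed.

Fact cone_le0_mul x y : cone_le 0 x -> cone_le 0 y -> cone_le 0 (x * y).
Proof. by move=> /cone_le0 ? /cone_le0 ?; apply/cone_le0; rewrite rmorphM; exact: coneM. Qed.

Fact cone_le0_anti x : cone_le 0 x -> cone_le x 0 -> x = 0.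
Proof.
move=> /cone_le0 ? /cone_le0N ?; apply/val_inj; rewrite rmorph0.
exact: cone_anti.
Qed.

Fact cone_sub_ge0 x y : cone_le 0 (y - x) = cone_le x y.
Proof. by rewrite /cone_le rmorph0 subr0 rmorphB. Qed.

Fact cone_le0_total x : cone_le 0 x || cone_le x 0.
Proof.
by apply/orP; have /cone_spanP[?|?] := valP x; [left; apply/cone_le0|right; apply/cone_le0N].
Qed.

Fact cone_normN x : cone_norm (- x) = cone_norm x.
Proof.
rewrite /cone_norm; have le0N : cone_le 0 (- x) = cone_le x 0.
  by rewrite -[in RHS]cone_sub_ge0 sub0r.
rewrite le0N opprK; case: (boolP (cone_le 0 x)); case: (boolP (cone_le x 0)) => //.
  by move=> h1 h2; rewrite (cone_le0_anti h2 h1) oppr0.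
by move=> h1 h2; have := cone_le0_total x; rewrite (negPf h1) (negPf h2).
Qed.

Fact cone_ge0_norm x : cone_le 0 x -> cone_norm x = x.
Proof. by rewrite /cone_norm => ->. Qed.

HB.instance Definition _ := Num.IntegralDomain_isLeReal.Build cone_field
  cone_le0_add cone_le0_mul cone_le0_anti cone_sub_ge0 cone_le0_total
  cone_normN cone_ge0_norm (fun _ _ => erefl).

Lemma cone_field_ge0 x : (0 <= x) <-> P (val x).
Proof. exact: cone_le0. Qed.

End ConeField.

Section SignChange.
Variable F : realFieldType.
Implicit Types (p q h : {poly F}).

(** If q changes sign then -1 is not a nonnegative combination of squares modulo
q. Reduce the squared polynomials modulo q: in 1 + s = q r the left side is positive at
a and at b, so r changes sign as well, and the degree of r is less than that of
q. The same relation holds with r in place of q, and infinite descent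
concludes. *)
Lemma sign_change_not_dvdp q (a b : F) (l : seq (F * {poly F})) :
  q.[a] * q.[b] < 0 -> all (fun u => 0 <= u.1) l ->
  ~~ (q %| 1 + \sum_(u <- l) u.1 *: u.2 ^+ 2).
Proof.
have [n] := ubnP (size q); elim: n q l => // n IHn q l /ltnSE qn qab l0.
apply/negP => qs.
have q0 : q != 0 by apply: contraTneq qab => ->; rewrite !horner0 mul0r ltxx.
pose l' := [seq (u.1, u.2 %% q) | u <- l].
pose s := 1 + \sum_(u <- l') u.1 *: u.2 ^+ 2.
have q_s : q %| s.
  have -> : s = (1 + \sum_(u <- l) u.1 *: u.2 ^+ 2) -
     (\sum_(u <- l) u.1 *: (u.2 ^+ 2 - (u.2 %% q) ^+ 2)).
    rewrite /s /l' big_map -addrA; congr (_ + _).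
    by rewrite -sumrB; apply: eq_bigr => u _; rewrite /= scalerBr opprB addrC subrK.
  rewrite dvdp_sub //; apply: (big_ind (fun x => q %| x)).
  - exact: dvdp0.
  - by move=> x y; exact: dvdp_add.
  - move=> u _; rewrite -mul_polyC dvdp_mull // subr_sqr dvdp_mulr //.
    by rewrite {1}(divp_eq u.2 q) addrK dvdp_mull.
have l'0 : all (fun u => 0 <= u.1) l' by rewrite all_map.
have s_pos x : 0 < s.[x].
  rewrite /s hornerD hornerC horner_sum ltr_pwDl ?ltr01 // big_seq sumr_ge0 // => u ul.
  by rewrite hornerZ horner_exp mulr_ge0 ?sqr_ge0 //; exact: (allP l'0).
pose r := s %/ q; have sE : s = r * q by rewrite /r divpK.
have rab : r.[a] * r.[b] < 0.
  have : 0 < (s.[a] * s.[b]) by rewrite mulr_gt0.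
  rewrite sE !hornerM mulrACA [_ * _ * _]mulrC => h.
  by rewrite -(nmulr_rgt0 _ qab).
have q1 : (1 < size q)%N.
  rewrite ltnNge; apply: contraTN qab => /size1_polyC ->.
  by rewrite !hornerC -leNgt -expr2 sqr_ge0.
have r_size : (size r < size q)%N.
  have r0 : r != 0 by apply: contraTneq rab => ->; rewrite !horner0 mul0r ltxx.
  have s_size : (size s <= (2 * size q - 3))%N.
    rewrite /s /l' big_map.
    apply: leq_trans (size_polyD _ _) _; rewrite geq_max size_poly1.
    apply/andP; split; first by lia.
    apply: (big_ind (fun p => (size p <= (2 * size q - 3))%N)).
    - by rewrite size_poly0.
    - move=> x y hx hy; apply: leq_trans (size_polyD _ _) _; by rewrite geq_max hx.
    - move=> u _; apply: leq_trans (size_scale_leq _ _) _.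
      rewrite expr2; apply: leq_trans (size_polyMleq _ _) _.
      have H : (size (u.2 %% q)%R < size q)%N by rewrite ltn_modp.
      rewrite [(_, _).2]/=; move: H q1; move: (size (u.2 %% q)%R) (size q) => m k; lia.
  move: s_size q1; rewrite sE size_mul //; move: (size r) (size q) => m k; lia.
have := IHn r l' (leq_trans r_size qn) rab l'0.
by rewrite -/s sE dvdp_mulr.
Qed.

Definition weighted_sos_mod q : set {poly F} :=
  [set s | exists l h, all (fun u => 0 <= u.1) l /\
     s = \sum_(u <- l) u.1 *: u.2 ^+ 2 + h * q].

Lemma weighted_sos_mod_preorder q : preorder (weighted_sos_mod q).
Proof.
split.
- move=> _ _ [l [h [l0 ->]]] [l' [h' [l'0 ->]]].
  exists (l ++ l'), (h + h'); split; first by rewrite all_cat l0.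
  by rewrite big_cat /=; ring.
- move=> _ _ [l [h [l0 ->]]] [l' [h' [l'0 ->]]].
  set s := \sum_(_ <- l) _; set s' := \sum_(_ <- l') _.
  exists [seq (u.1 * v.1, u.2 * v.2) | u <- l, v <- l'],
    (h * s' + s * h' + h * h' * q); split.
    apply/allP => _ /allpairsP[[u v] [/= ul vl ->]].
    by rewrite /= mulr_ge0 ?(allP l0 u ul) ?(allP l'0 v vl).
  rewrite big_allpairs_dep.
  have -> : \sum_(u <- l) \sum_(v <- l') (u.1 * v.1, u.2 * v.2).1 *:
      (u.1 * v.1, u.2 * v.2).2 ^+ 2 = s * s'.
    rewrite /s big_distrl; apply: eq_bigr => u _.
    rewrite /s' big_distrr; apply: eq_bigr => v _ /=.
    by rewrite exprMn -scalerAl -scalerAr scalerA.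
  by ring.
- move=> h; exists [:: (1, h)], 0; split; first by rewrite /= ler01.
  by rewrite big_seq1 scale1r mul0r addr0.
Qed.

(** This orders the extension of F by a root of q whenever q is irreducible. *)
Lemma sign_change_prime_cone q (a b : F) : q.[a] * q.[b] < 0 ->
  exists T : set {poly F}, [/\ prime_cone T, support T q & forall c, 0 <= c -> T c%:P].
Proof.
move=> qab; have pT0 := weighted_sos_mod_preorder q.
have T0q h : weighted_sos_mod q (h * q).
  by exists [::], h; split=> //; rewrite big_nil add0r.
have T0C c : 0 <= c -> weighted_sos_mod q c%:P.
  move=> c0; exists [:: (c, 1)], 0; split; first by rewrite /= c0.
  by rewrite big_seq1 mul0r addr0 expr1n alg_polyC.
have [||_ ->|_ ->|T [T0T coneT _]] := @maximal_preorder _ (weighted_sos_mod q) [set 1] pT0.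
- by [].
- by move=> x y -> ->; rewrite mulr1.
- exact: preorder1.
- move=> [l [h [l0 E]]]; have /negP := sign_change_not_dvdp qab l0; apply.
  have -> : 1 + \sum_(u <- l) u.1 *: u.2 ^+ 2 = - h * q.
    have -> : \sum_(u <- l) u.1 *: u.2 ^+ 2 = -1 - h * q by rewrite E; ring.
    by ring.
  exact: dvdp_mulIr.
exists T; split=> //; last by move=> c c0; apply: T0T; exact: T0C.
by split; apply: T0T; have := T0q 1; have := T0q (-1); rewrite mul1r mulN1r.
Qed.

(** A reducible polynomial that changes sign has a proper factor that changes
sign, so the intermediate value property needs checking on irreducible ones only. *)
Lemma sign_change_ivt :
  (forall q (a b : F), irreducible_poly q -> q.[a] * q.[b] < 0 -> exists x, root q x) ->
  Num.real_closed_axiom F.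
Proof.
move=> irr_root p a b ab /andP[pa pb].
have ivt : forall q, q.[a] * q.[b] < 0 -> exists2 x, a <= x <= b & root q x.
  move=> q; have [n] := ubnP (size q); elim: n q => // n IHn q /ltnSE qn qab.
  have q0 : q != 0 by apply: contraTneq qab => ->; rewrite !horner0 mul0r ltxx.
  have q1 : (1 < size q)%N.
    rewrite ltnNge; apply: contraTN qab => /size1_polyC ->.
    by rewrite !hornerC -leNgt -expr2 sqr_ge0.
  have [irr|] := pselect (irreducible_poly q).
    have [x rx] := irr_root q a b irr qab; exists x => //.
    have : 'X - x%:P %= q by apply: irr.2; rewrite ?size_XsubC // dvdp_XsubCl.
    rewrite eqp_sym => /eqpf_eq[c c0 qE].
    move: qab; rewrite qE !hornerZ !hornerXsubC mulrACA -expr2 => xab.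
    have {}c0 : 0 < c ^+ 2 by rewrite exprn_even_gt0.
    move: xab; rewrite pmulr_rlt0 // => xab.
    apply/andP; split; rewrite leNgt; apply: contraTN xab => xab; rewrite -leNgt.
      by rewrite mulr_ge0 // subr_ge0 ltW // (lt_le_trans xab).
    by rewrite mulr_le0 // subr_le0 ltW // (le_lt_trans ab).
  move=> nirr; have [h [h1 hq nhq]] : exists h, [/\ size h != 1%N, h %| q & ~~ (h %= q)].
    apply: contrapT => nex; apply: nirr; split=> // h h1 hq.
    by apply: contrapT => /negP nhq; apply: nex; exists h.
  have qE := divpK hq; set u := q %/ h in qE.
  have [u0 h0] : u != 0 /\ h != 0 by apply/andP; rewrite -negb_or -mulf_eq0 qE.
  have qsz : size q = (size u + size h).-1 by rewrite -qE size_mul.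
  have u1 : size u != 1%N.
    apply: contra nhq => /size_poly1P[c c0 uE].
    by rewrite -qE uE mul_polyC eqp_sym eqp_scale.
  have [su sh] : ((size u < size q) /\ (size h < size q))%N.
    move: qsz u1 h1 (u0) (h0); rewrite -!size_poly_gt0.
    by move: (size u) (size h) (size q) => i j k; lia.
  have : (u.[a] * u.[b]) * (h.[a] * h.[b]) < 0.
    by rewrite mulrACA -!hornerM qE.
  have [uab _|uab huab] := ltP (u.[a] * u.[b]) 0.
    have [x xab rx] := IHn u (leq_trans su qn) uab.
    by exists x => //; rewrite -qE rootM rx.
  have hab : h.[a] * h.[b] < 0.
    by rewrite ltNge; apply: contraTN huab => hab; rewrite -leNgt mulr_ge0.
  have [x xab rx] := IHn h (leq_trans sh qn) hab.
  by exists x => //; rewrite -qE rootM rx orbT.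
have [pa0|pa0] := eqVneq p.[a] 0.
  by exists a; rewrite ?lexx ?ab //; apply/eqP.
have [pb0|pb0] := eqVneq p.[b] 0.
  by exists b; rewrite ?lexx ?ab //; apply/eqP.
by apply: ivt; rewrite nmulr_rlt0 lt_neqAle ?pa0 // eq_sym pb0.
Qed.

End SignChange.

(** A maximal ordered subfield F of an algebraically closed field is real closed.
An irreducible q over F that changes sign has a root alpha in C, and
[sign_change_prime_cone] orders F(alpha); maximality puts alpha in F. *)
Lemma maximal_cone_real_closed (C : closedFieldType) (P : subfield_cone C) :
  (forall Q, is_subfield_cone Q -> P `<=` Q -> Q `<=` P) ->
  Num.real_closed_axiom (cone_field P).
Proof.
move=> Pmax; pose F := cone_field P.
apply: sign_change_ivt => q a b irr qab.
have [T [coneT sTq TC]] := sign_change_prime_cone qab.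
have pT := prime_cone_preorder coneT.
pose toC : {rmorphism F -> C} := \val.
have [alpha q_alpha] : exists x, root (map_poly toC q) x.
  by apply/closed_rootP; rewrite size_map_poly; case: irr => /gtn_eqF ->.
pose ev (h : {poly F}) := (map_poly toC h).[alpha].
have evD h k : ev (h + k) = ev h + ev k by rewrite /ev rmorphD hornerD.
have evM h k : ev (h * k) = ev h * ev k by rewrite /ev rmorphM hornerM.
have evN h : ev (- h) = - ev h by rewrite /ev rmorphN hornerN.
have evC c : ev c%:P = toC c by rewrite /ev map_polyC hornerC.
have ev1 : ev 1 = 1 by rewrite /ev rmorph1 hornerC.
have evq : ev q = 0 by apply/eqP.
have ev0 : ev 0 = 0 by rewrite /ev rmorph0 horner0.
have bezout h : ~~ (q %| h) -> exists u v, u * q + v * h = 1.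
  rewrite -(irreducible_poly_coprime _ irr) => /Bezout_eq1_coprimepP[[u v] uv].
  by exists u, v.
have ev_dvd h : ev h = 0 -> q %| h.
  move=> h0; apply: contrapT => /negP /bezout[u [v uv]].
  by have /eqP := oner_neq0 C; apply; rewrite -ev1 -uv evD !evM evq h0 !mulr0 addr0.
have supp_dvd h : q %| h -> support T h.
  move=> /dvdpP[k ->]; rewrite mulrC.
  have [Tk|TNk] := prime_cone_total coneT k; first exact: supportM.
  have [h1 h2] := supportM pT sTq TNk.
  by split; rewrite -?mulrN // -[q * k]opprK -mulrN.
have QP : is_subfield_cone (ev @` T).
  split.
  - by move=> _ _ [h Th <-] [k Tk <-]; exists (h + k) => //; exact: preorderD.
  - by move=> _ _ [h Th <-] [k Tk <-]; exists (h * k) => //; exact: preorderM.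
  - move=> _ [h Th <-]; have [h0|h0] := eqVneq (ev h) 0.
      by rewrite h0 invr0; exists 0 => //; exact: preorder0.
    have [|u [v uv]] := bezout h.
      by apply: contra h0 => /dvdpP[k ->]; rewrite evM evq mulr0.
    have vh : ev v * ev h = 1 by rewrite -evM -ev1 -uv evD !evM evq mulr0 add0r.
    exists (v ^+ 2 * h); first by apply: preorderM => //; exact: preorder_sqr.
    apply: (mulIf h0); rewrite mulVf // expr2 -mulrA evM evM vh mulr1 //.
  - split; first by exists 1 => //; exact: preorder1.
    move=> [h Th hN1]; apply: (prime_coneN1 coneT).
    have /supp_dvd[_ TN] : q %| h + 1 by apply: ev_dvd; rewrite evD hN1 ev1 addNr.
    have -> : -1 = h + - (h + 1) by rewrite opprD addrA subrr add0r.
    exact: preorderD.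
  - move=> _ _ [h Th <-] [k Tk <-].
    have [Thk|Thk] := prime_cone_total coneT (h - k).
      by left; exists (h - k); rewrite // evD evN.
    by right; exists (k - h); rewrite ?evD ?evN // -opprB.
have PQ : P `<=` ev @` T.
  move=> x Px; have xF : x \in cone_span P by apply/cone_spanP; left.
  exists (ConeFieldElt xF)%:P; last by rewrite evC.
  by apply: TC; apply/cone_field_ge0.
have alphaF : alpha \in cone_span P.
  have evX : ev 'X = alpha by rewrite /ev map_polyX hornerX.
  apply/cone_spanP; have [TX|TNX] := prime_cone_total coneT 'X.
    by left; apply: (Pmax _ QP PQ); exists 'X.
  by right; apply: (Pmax _ QP PQ); exists (- 'X) => //; rewrite evN evX.
exists (ConeFieldElt alphaF).
rewrite -(fmorph_root toC); exact: q_alpha.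
Qed.

(** The residue field of T embeds in an algebraically closed field C, where Zorn's
lemma yields an ordered subfield that is maximal among those extending the
ordering. The injection in the integers makes the residue field countable, so that
C can be obtained as a direct limit of finite extensions. *)
Lemma real_closed_realization (A : comNzRingType) (T : set A) (code : A -> nat) :
  injective code -> prime_cone T ->
  exists (L : rcfType) (chi : {rmorphism A -> L}), forall x, 0 <= chi x <-> T x.
Proof.
move=> code_inj coneT; have pT := prime_cone_preorder coneT.
have [C [i iT]] := cone_closed_field code_inj coneT.
(* The cone of the residue field: fractions of elements of T. *)
pose P0 := [set z | exists a b, [/\ T a, T b, i b != 0 & z = i a / i b]].
have P0i a : T a -> P0 (i a).
  move=> Ta; exists a, 1; split=> //; first exact: preorder1.
    by rewrite rmorph1 oner_neq0.
  by rewrite rmorph1 divr1.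
have iN a : T a -> T (- a) -> i a = 0 by move=> ? ?; apply/iT.
have cone0P : is_subfield_cone P0.
  split.
  - move=> _ _ [a [b [Ta Tb b0 ->]]] [a' [b' [Ta' Tb' b'0 ->]]].
    exists (a * b' + a' * b), (b * b'); split.
    + by apply: preorderD => //; exact: preorderM.
    + exact: preorderM.
    + by rewrite rmorphM mulf_neq0.
    + by rewrite addf_div // rmorphD !rmorphM.
  - move=> _ _ [a [b [Ta Tb b0 ->]]] [a' [b' [Ta' Tb' b'0 ->]]].
    exists (a * a'), (b * b'); split; try exact: preorderM.
      by rewrite rmorphM mulf_neq0.
    by rewrite mulf_div !rmorphM.
  - move=> _ [a [b [Ta Tb b0 ->]]]; have [a0|a0] := eqVneq (i a) 0.
      by rewrite a0 mul0r invr0 -(rmorph0 i); apply: P0i; exact: preorder0.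
    by exists b, a; split=> //; rewrite invf_div.
  - split; first by rewrite -(rmorph1 i); apply: P0i; exact: preorder1.
    move=> [a [b [Ta Tb b0 /esym]]] /(canRL (divfK b0)) ab.
    have [|_ TN] := (iT (a + b)).1; first by rewrite rmorphD ab mulN1r addNr.
    have /negP := b0; apply; apply/eqP; apply: iN => //.
    have -> : - b = a + - (a + b) by ring.
    exact: preorderD.
  - move=> _ _ [a [b [Ta Tb b0 ->]]] [a' [b' [Ta' Tb' b'0 ->]]].
    have TbB : T (b * b') by exact: preorderM.
    have bb0 : i (b * b') != 0 by rewrite rmorphM mulf_neq0.
    have [H|H] := prime_cone_total coneT (a * b' - a' * b); [left|right].
      exists (a * b' - a' * b), (b * b'); split=> //.
      by rewrite -mulNr addf_div // rmorphB !rmorphM mulNr.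
    exists (a' * b - a * b'), (b * b'); split=> //; first by rewrite -opprB.
    by rewrite -mulNr addf_div // rmorphB !rmorphM mulNr [i b' * _]mulrC.
have [|P [PP P0P Pmax]] := @Zorn_above C (@is_subfield_cone C) P0 cone0P.
  move=> F [X FX] FP Ftot.
  have join x y : (\bigcup_(X in F) X) x -> (\bigcup_(X in F) X) y ->
      exists Z, [/\ F Z, Z x & Z y].
    move=> [Y FY Yx] [Z FZ Zy]; case: (Ftot Y Z FY FZ) => sub.
      by exists Z; split=> //; exact: sub.
    by exists Y; split=> //; exact: sub.
  split.
  - move=> x y /join H /H[Z [FZ Zx Zy]]; exists Z => //.
    by have [h _ _ _ _] := FP Z FZ; exact: h.
  - move=> x y /join H /H[Z [FZ Zx Zy]]; exists Z => //.
    by have [_ h _ _ _] := FP Z FZ; exact: h.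
  - move=> x [Z FZ Zx]; exists Z => //.
    by have [_ _ h _ _] := FP Z FZ; exact: h.
  - split; first by exists X => //; have [_ _ _ [? _] _] := FP X FX.
    by move=> [Z FZ]; have [_ _ _ [_ h] _] := FP Z FZ.
  - move=> x y /join H /H[Z [FZ Zx Zy]].
    have [_ _ _ _ h] := FP Z FZ.
    by have [?|?] := h x y Zx Zy; [left|right]; exists Z.
pose PC := SubfieldCone PP; pose F := cone_field PC.
have rcF : Num.real_closed_axiom F.
  by apply: maximal_cone_real_closed => Q; exact: Pmax.
have iF x : i x \in cone_span PC.
  apply/cone_spanP; have [Tx|TNx] := prime_cone_total coneT x.
    by left; apply: P0P; exact: P0i.
  by right; rewrite -rmorphN; apply: P0P; exact: P0i.
pose chi x : F := ConeFieldElt (iF x).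
have chi_zmod : zmod_morphism chi by move=> x y; apply/val_inj; rewrite [RHS]rmorphB [LHS]rmorphB.
have chi_mon : monoid_morphism chi.
  by split=> [|x y]; apply/val_inj; [rewrite [LHS]rmorph1 [RHS]rmorph1|rewrite [LHS]rmorphM [RHS]rmorphM].
pose L : rcfType := HB.pack F (Num.RealField_isClosed.Build F rcF).
pose chiM : {rmorphism A -> L} := HB.pack (chi : A -> L)
  (GRing.isZmodMorphism.Build A L chi chi_zmod)
  (GRing.isMonoidMorphism.Build A L chi chi_mon).
exists L, chiM => x; rewrite (cone_field_ge0 (chi x)) /=.
split=> [Pix|Tx]; last by apply: P0P; exact: P0i.
have [//|TNx] := prime_cone_total coneT x.
suff /iT[] : i x = 0 by [].
by apply: (@cone_anti _ PC) => //; rewrite -rmorphN; apply: P0P; exact: P0i.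
Qed.

(** * Quantities determined by finitely many signs *)

Section SignDetermined.
Import Pdiv.Ring Pdiv.ComRing.
Variable D : comNzRingType.
Implicit Types (p q h g : {poly D}).

Definition same_signs (H : seq D) (R L : rcfType)
    (phi : {rmorphism D -> R}) (psi : {rmorphism D -> L}) :=
  {in H, forall a, sgz (phi a) = sgz (psi a)}.

(** A quantity attaches a value to every specialization of the coefficient ring
D in a real closed field. It is determined when finitely many elements of D,
chosen once for all, decide the value by their signs. *)
Definition quantity (T : Type) := forall R : rcfType, {rmorphism D -> R} -> T.

Definition determined_on T (Q : quantity Prop) (X : quantity T) :=
  exists H : seq D, forall (R L : rcfType) (phi : {rmorphism D -> R}) (psi : {rmorphism D -> L}),
    Q R phi -> Q L psi -> same_signs H phi psi -> X R phi = X L psi.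

Definition determined T (X : quantity T) :=
  exists H : seq D, forall (R L : rcfType) (phi : {rmorphism D -> R}) (psi : {rmorphism D -> L}),
    same_signs H phi psi -> X R phi = X L psi.

Lemma same_signs_cat H H' (R L : rcfType) (phi : {rmorphism D -> R}) (psi : {rmorphism D -> L}) :
  same_signs (H ++ H') phi psi -> same_signs H phi psi /\ same_signs H' phi psi.
Proof.
by move=> S; split=> a aH; apply: S; rewrite mem_cat aH ?orbT.
Qed.

Lemma determined_sub T (X : quantity T) Q : determined X -> determined_on Q X.
Proof. by move=> [H HP]; exists H => R L phi psi _ _; exact: HP. Qed.

Lemma determined_ext_on T (Q : quantity Prop) (X Y : quantity T) :
  (forall R phi, Q R phi -> X R phi = Y R phi) -> determined_on Q X -> determined_on Q Y.
Proof.
move=> XY [H HP]; exists H => R L phi psi Qphi Qpsi S.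
by rewrite -(XY _ _ Qphi) -(XY _ _ Qpsi); exact: HP.
Qed.

Lemma determined_ext T (X Y : quantity T) :
  (forall R phi, X R phi = Y R phi) -> determined X -> determined Y.
Proof.
by move=> XY [H HP]; exists H => R L phi psi S; rewrite -!XY; exact: HP.
Qed.

Lemma determined_on_map2 T1 T2 T (f : T1 -> T2 -> T) Q (X : quantity T1) (Y : quantity T2) :
  determined_on Q X -> determined_on Q Y ->
  determined_on Q (fun R phi => f (X R phi) (Y R phi)).
Proof.
move=> [H HP] [H' HP']; exists (H ++ H') => R L phi psi Qphi Qpsi.
move=> /same_signs_cat[S S'].
by rewrite (HP _ _ _ _ Qphi Qpsi S) (HP' _ _ _ _ Qphi Qpsi S').
Qed.

Lemma determined_map2 T1 T2 T (f : T1 -> T2 -> T) (X : quantity T1) (Y : quantity T2) :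
  determined X -> determined Y -> determined (fun R phi => f (X R phi) (Y R phi)).
Proof.
move=> [H HP] [H' HP']; exists (H ++ H') => R L phi psi /same_signs_cat[S S'].
by rewrite (HP _ _ _ _ S) (HP' _ _ _ _ S').
Qed.

Lemma determined_cst T (c : T) : determined (fun R phi => c).
Proof. by exists [::]. Qed.

Lemma determined_sgz (a : D) : determined (fun R phi => sgz (phi a)).
Proof. by exists [:: a] => R L phi psi; apply; rewrite mem_head. Qed.

Lemma determined_family T (I : finType) (X : I -> quantity T) :
  (forall i, determined (X i)) ->
  exists H : seq D, forall (R L : rcfType) (phi : {rmorphism D -> R}) (psi : {rmorphism D -> L}),
    same_signs H phi psi -> forall i, X i R phi = X i L psi.
Proof.
move=> /choice[Hf HfP]; exists (flatten [seq Hf i | i <- enum I]).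
move=> R L phi psi S i; apply: HfP => a aH; apply: S.
by apply/flattenP; exists (Hf i) => //; rewrite map_f // mem_enum.
Qed.

(** Case distinction: the signs that decide Y may depend on the value of the bounded
quantity X. *)
Lemma determined_bind T (X : quantity nat) (Y : quantity T) N :
  determined X -> (forall R phi, (X R phi < N)%N) ->
  (forall m, determined_on (fun R phi => X R phi = m) Y) -> determined Y.
Proof.
move=> [H HP] XN /choice[Hf HfP].
exists (H ++ flatten [seq Hf m | m <- iota 0 N]).
move=> R L phi psi /same_signs_cat[/HP XE S].
apply: (HfP (X L psi)) => // a aH; apply: S; apply/flattenP.
by exists (Hf (X L psi)) => //; rewrite map_f // mem_iota /= add0n.
Qed.

Lemma determined_size p : determined (fun R phi => size (map_poly phi p)).
Proof.
exists p => R L phi psi S.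
have zE i : ((map_poly phi p)`_i == 0) = ((map_poly psi p)`_i == 0).
  rewrite !coef_map /= -[LHS]sgz_eq0 -[RHS]sgz_eq0.
  have [ip|ip] := ltnP i (size p); first by rewrite S ?mem_nth.
  by rewrite nth_default // !rmorph0 !sgz0.
apply/eqP; rewrite eqn_leq; apply/andP; split; apply/leq_sizeP => j jp; apply/eqP.
  by rewrite zE nth_default.
by rewrite -zE nth_default.
Qed.

Lemma determined_coef_sgz p i : determined (fun R phi => sgz (map_poly phi p)`_i).
Proof.
by apply: (determined_ext _ (determined_sgz p`_i)) => R phi; rewrite coef_map.
Qed.

Lemma determined_lead_coef p :
  determined (fun R phi => sgz (lead_coef (map_poly phi p))).
Proof.
apply: (determined_bind (determined_size p) (N := (size p).+1)).
  by move=> R phi; rewrite ltnS size_poly.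
move=> m; apply: determined_ext_on (determined_sub _ (determined_coef_sgz p m.-1)).
by move=> R phi <-.
Qed.

Lemma variation_sgz (R : rcfType) (x y : R) :
  variation x y = sgz y * (sgz x * sgz y < 0).
Proof. by rewrite /variation -sgz_cp0 sgzM; do 2?case: sgzP => _. Qed.

Lemma sgp_infty_sgz (R : rcfType) (p : {poly R}) :
  sgz (sgp_pinfty p) = sgz (lead_coef p) /\
  sgz (sgp_minfty p) = (-1) ^+ (size p).-1 * sgz (lead_coef p).
Proof.
rewrite /sgp_pinfty /sgp_minfty !sgz_sgr sgzM sgzX; split=> //.
by rewrite sgzN1.
Qed.

Lemma determined_crossR p : determined (fun R phi => crossR (map_poly phi p)).
Proof.
pose f (s : int) (m : nat) : int := s * ((-1) ^+ m.-1 * s * s < 0).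
apply: determined_ext (determined_map2 f (determined_lead_coef p) (determined_size p)).
move=> R phi; rewrite /crossR variation_sgz.
by have [-> ->] := sgp_infty_sgz (map_poly phi p).
Qed.

Lemma cindexR_mulCp (R : rcfType) (c : R) (p q : {poly R}) :
  cindexR (c *: p) q = sgz c * cindexR p q.
Proof. by rewrite /cindexR mulr_sumr; apply: eq_bigr => x _; exact: jump_mulCp. Qed.

(** Specialization does not commute with the pseudo-remainder, since leading
coefficients may vanish along the way. When that of q survives, the two
remainders differ by powers of it, and the Cauchy index sees these through the
sign of the coefficient. *)
Lemma cindexR_next_mod_map (R : rcfType) (phi : {rmorphism D -> R}) p q :
  phi (lead_coef q) != 0 ->
  cindexR (next_mod (map_poly phi p) (map_poly phi q)) (map_poly phi q) =
  - sgz (phi (lead_coef q)) ^+ rscalp p q *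
    cindexR (map_poly phi (rmodp p q)) (map_poly phi q).
Proof.
move=> c0; set P := map_poly phi p; set Q := map_poly phi q.
set c := phi (lead_coef q); set k := rscalp p q; set r := map_poly phi _.
have Qlc : lead_coef Q = c by rewrite lead_coef_map_eq.
have Qsize : size Q = size q by rewrite size_map_poly_id0.
have q0 : q != 0 by apply: contraNneq c0 => ->; rewrite lead_coef0 rmorph0.
have Q0 : Q != 0 by rewrite -size_poly_gt0 Qsize size_poly_gt0.
have Pk : c ^+ k *: P = map_poly phi (rdivp p q) * Q + r.
  have := congr1 (map_poly phi) (rdivp_eq q p).
  by rewrite rmorphD rmorphM /= map_polyZ rmorphXn.
pose j := rscalp P Q.
have Pj : c ^+ j *: P = rdivp P Q * Q + rmodp P Q by rewrite -rdivp_eq Qlc.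
have rem : c ^+ k *: rmodp P Q = c ^+ j *: r.
  have E1 : modp (c ^+ j *: P) Q = rmodp P Q.
    by rewrite Pj modpD modp_mull add0r modp_small // ltn_rmodp.
  have E2 : modp (c ^+ k *: P) Q = r.
    rewrite Pk modpD modp_mull add0r modp_small // Qsize.
    by apply: leq_ltn_trans (size_poly _ _) _; rewrite ltn_rmodp.
  by rewrite -E1 -E2 -!modpZl !scalerA mulrC.
have sg2 : sgz c * sgz c = 1 :> int by rewrite mulz_sg c0.
have sgk i : (sgz c) ^+ i * (sgz c) ^+ i = 1 by rewrite -exprMn sg2 expr1n.
have E : cindexR (c ^+ k *: rmodp P Q) Q = cindexR (c ^+ j *: r) Q by rewrite rem.
rewrite !cindexR_mulCp !sgzX in E.
rewrite /next_mod cindexR_mulCp sgzN sgzX Qlc -/j !mulNr; congr (- _).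
have -> : cindexR (rmodp P Q) Q = sgz c ^+ k * (sgz c ^+ j * cindexR r Q).
  by rewrite -E mulrA sgk mul1r.
by rewrite mulrCA [X in _ * X]mulrA sgk mul1r.
Qed.

Lemma map_take_poly (R : rcfType) (phi : {rmorphism D -> R}) q :
  map_poly phi (take_poly (size (map_poly phi q)) q) = map_poly phi q.
Proof.
apply/polyP => i; rewrite !coef_map /= coef_take_poly.
case: ltnP => // iq; rewrite rmorph0.
by rewrite -coef_map nth_default.
Qed.

(** Euclid's algorithm: after truncating q at its degree in the specialization,
the Cauchy index of q / p reduces to that of the remainder over q, up to a term that
depends on leading coefficients and degrees. *)
Lemma determined_cindexR p q :
  determined (fun R phi => cindexR (map_poly phi q) (map_poly phi p)).
Proof.
have [n] := ubnP (size q); elim: n p q => // n IHn p q /ltnSE qn.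
apply: (determined_bind (determined_size q) (N := (size q).+1)).
  by move=> R phi; rewrite ltnS size_poly.
case=> [|m].
  apply: determined_ext_on (determined_sub _ (determined_cst (0 : int))) => R phi /eqP.
  by rewrite size_poly_eq0 => /eqP ->; rewrite cindexR0p.
pose q' := take_poly m.+1 q; pose c := q`_m.
have q'size : (size q' <= m.+1)%N by exact: size_take_poly.
have [c0|c0] := eqVneq c 0.
  exists [::] => R L phi psi qm _ _.
  have : lead_coef (map_poly phi q) != 0.
    by rewrite lead_coef_eq0 -size_poly_gt0 qm.
  by rewrite lead_coefE qm coef_map /= -/c c0 rmorph0 eqxx.
have q'm : q'`_m = c by rewrite coef_take_poly ltnS leqnn.
have sq' : size q' = m.+1.
  apply/eqP; rewrite eqn_leq q'size /= ltnNge; apply: contraNN c0 => qm.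
  by rewrite -q'm nth_default.
have lq' : lead_coef q' = c by rewrite lead_coefE sq'.
pose k := rscalp p q'; pose r := rmodp p q'.
have mq : (m < size q)%N by rewrite ltnNge; apply: contraNN c0 => qm; rewrite /c nth_default.
have rn : (size r < n)%N.
  apply: leq_trans qn; apply: leq_trans mq; rewrite -sq' ltn_rmodp.
  by rewrite -size_poly_gt0 sq'.
pose f (a : int) (b : int * int) : int := a + (- b.1 ^+ k * b.2).
apply: determined_ext_on (determined_on_map2 f
  (determined_sub _ (determined_crossR (p * q)))
  (determined_on_map2 pair (determined_sub _ (determined_sgz c))
     (determined_sub _ (IHn q' r rn)))).
move=> R phi qm; rewrite /f /= rmorphM [RHS]cindexR_rec; congr (_ + _).
have qq' : map_poly phi q = map_poly phi q' by rewrite -[LHS]map_take_poly qm.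
have c_neq0 : phi (lead_coef q') != 0.
  rewrite lq' /c; have : lead_coef (map_poly phi q) != 0.
    by rewrite lead_coef_eq0 -size_poly_gt0 qm.
  by rewrite lead_coefE qm coef_map.
by rewrite qq' cindexR_next_mod_map // lq'.
Qed.

Lemma determined_taq p g :
  determined (fun R phi => taq (rootsR (map_poly phi p)) (map_poly phi g)).
Proof.
apply: determined_ext (determined_cindexR p (p^`() * g)) => R phi.
rewrite rmorphM /= -deriv_map; apply/esym; exact: taq_cindex.
Qed.

(** With g = 1 this counts the roots of p at which every polynomial of l has the
sign attached to it; the weight by the sign of g makes an induction on l
possible. *)
Definition sign_count (p g : {poly D}) (l : seq ({poly D} * int)) : quantity int :=
  fun R phi => \sum_(x <- rootsR (map_poly phi p))
    sgz (map_poly phi g).[x] * \prod_(u <- l) (sgz (map_poly phi u.1).[x] == u.2 :> int)%:R.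

(** The indicators of h > 0, h < 0 and h = 0 are (s^2 + s) / 2, (s^2 - s) / 2
and 1 - s^2, where s is the sign of h. Each constraint is thus traded for the
weights g h and g h^2, until only Tarski queries are left. *)
Lemma determined_sign_count p g l : determined (sign_count p g l).
Proof.
elim: l g => [|[h s] l IHl] g.
  apply: determined_ext (determined_taq p g) => R phi.
  by apply: eq_bigr => x _; rewrite big_nil mulr1.
have [s1|s1] := eqVneq s 1.
  (* Division by 2 is exact here: the two counts add up to twice the one sought. *)
  pose f (a b : int) : int := ((a + b) %/ 2)%Z.
  apply: determined_ext (determined_map2 f (IHl (g * h)) (IHl (g * (h * h)))).
  move=> R phi; rewrite /f /sign_count -big_split /=.
  set S := \sum_(_ <- _) _; set S' := RHS.
  suff -> : S = S' * 2 by rewrite mulzK.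
  rewrite /S /S' mulr_suml; apply: eq_bigr => x _.
  rewrite big_cons /= s1 !rmorphM /= !hornerM !sgzM.
  by case: (sgzP (map_poly phi h).[x]) => _; rewrite /=; ring.
have [sN1|sN1] := eqVneq s (-1).
  pose f (a b : int) : int := ((b - a) %/ 2)%Z.
  apply: determined_ext (determined_map2 f (IHl (g * h)) (IHl (g * (h * h)))).
  move=> R phi; rewrite /f /sign_count -sumrB /=.
  set S := \sum_(_ <- _) _; set S' := RHS.
  suff -> : S = S' * 2 by rewrite mulzK.
  rewrite /S /S' mulr_suml; apply: eq_bigr => x _.
  rewrite big_cons /= sN1 !rmorphM /= !hornerM !sgzM.
  by case: (sgzP (map_poly phi h).[x]) => _; rewrite /=; ring.
have [s0|s0] := eqVneq s 0.
  pose f (a b : int) : int := a - b.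
  apply: determined_ext (determined_map2 f (IHl g) (IHl (g * (h * h)))).
  move=> R phi; rewrite /f /sign_count -sumrB /=.
  apply: eq_bigr => x _.
  rewrite big_cons /= s0 !rmorphM /= !hornerM !sgzM.
  by case: (sgzP (map_poly phi h).[x]) => _; rewrite /=; ring.
apply: determined_ext (determined_cst (0 : int)) => R phi.
rewrite /sign_count big1 // => x _; rewrite big_cons /=.
suff -> : (sgz (map_poly phi h).[x] == s :> int) = false by rewrite mul0r mulr0.
by case: (sgzP (map_poly phi h).[x]) => _; rewrite eq_sym; apply: negbTE.
Qed.

Lemma sign_count_gt0P (R : rcfType) (phi : {rmorphism D -> R}) p l :
  map_poly phi p != 0 ->
  reflect (exists2 x, root (map_poly phi p) x &
             forall u, u \in l -> sgz (map_poly phi u.1).[x] = u.2)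
    (sign_count p 1 l phi != 0).
Proof.
move=> p0; rewrite /sign_count.
have -> : \sum_(x <- rootsR (map_poly phi p)) sgz (map_poly phi 1).[x] *
    \prod_(u <- l) (sgz (map_poly phi u.1).[x] == u.2 :> int)%:R =
  (count (fun x => all (fun u => sgz (map_poly phi u.1).[x] == u.2 :> int) l)
     (rootsR (map_poly phi p)))%:R.
  rewrite -sum1_count natr_sum [RHS]big_mkcond /=; apply: eq_bigr => x _.
  rewrite rmorph1 hornerC sgz1 mul1r.
  by elim: l => [|u l IHl]; rewrite ?big_nil // big_cons IHl /=; case: eqP => _; rewrite ?mul1r ?mul0r.
rewrite pnatr_eq0 -lt0n -has_count.
apply: (iffP hasP) => [[x rx /allP xl]|[x rx xl]].
  exists x; last by move=> u /xl/eqP.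
  by move: rx; rewrite -roots_on_rootsR.
exists x; first by rewrite -roots_on_rootsR.
by apply/allP => u /xl ->.
Qed.

End SignDetermined.

(** * Transfer of sign conditions between real closed fields *)

Section Step.
Variables (D : comNzRingType) (k : nat) (h : 'I_k -> {poly D}).

(** Signs are indexed by a finite type so that finitely many sign vectors have
to be considered. *)
Definition sign3 (j : 'I_3) : int := j%:Z - 1.

Lemma sign3_sgz (R : realDomainType) (x : R) : exists j, sgz x = sign3 j.
Proof.
by case: sgzP => _; [exists (inord 1)|exists (inord 2)|exists (inord 0)];
  rewrite /sign3 inordK.
Qed.

Lemma sign3_mul_gt0 (R : realDomainType) (j : 'I_3) (x : R) :
  sign3 j != 0 -> (0 < (sign3 j)%:~R * x) = (sgz x == sign3 j).
Proof.
case: j => [[|[|[|//]]] ?]; rewrite /sign3 //= => _.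
  by rewrite sub0r mulrN1z mulN1r oppr_gt0; case: sgzP.
by rewrite [_ - _]/(1 : int) mul1r; case: sgzP.
Qed.

Definition sign_conditions (sigma : {ffun 'I_k -> 'I_3}) :=
  [seq (h i, sign3 (sigma i)) | i <- enum 'I_k].

(** Between two roots of a product of the h i, its derivative has a root. The
factor X^2 + 1, positive everywhere, keeps the product from being constant and
hence the derivative from being zero. *)
Definition bounding_map (S : {set 'I_k}) : {poly D} :=
  (('X^2 + 1) * \prod_(i in S) h i)^`().

Definition signed_maps (R : rcfType) (phi : {rmorphism D -> R})
    (S : {set 'I_k}) (sigma : {ffun 'I_k -> 'I_3}) : seq {poly R} :=
  ('X^2 + 1) :: [seq (sign3 (sigma i))%:~R *: map_poly phi (h i) | i <- enum S].

Lemma size_sqrX_add1 (R : rcfType) : size ('X^2 + 1 : {poly R}) = 3%N.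
Proof. by rewrite size_polyDl ?size_polyXn // size_poly1. Qed.

(** Elimination of one variable. If theta is a root of some nonzero h i, the number
of roots of h i with the same signs is positive over L, hence over R.
Otherwise theta lies in an open interval cut out by the roots of the h i: an
unbounded one, described by leading coefficients, or a bounded one, which
contains a root of the derivative of their product. *)
Lemma sign_transfer_step :
  exists H : seq D, forall (R L : rcfType) (phi : {rmorphism D -> R})
    (psi : {rmorphism D -> L}), same_signs H phi psi ->
  forall theta : L, exists y : R,
    forall i, sgz (map_poly phi (h i)).[y] = sgz (map_poly psi (h i)).[theta].
Proof.
have [H1 H1P] := determined_family (fun i => determined_size (h i)).
have [H2 H2P] := determined_family (fun i => determined_lead_coef (h i)).
have [H3 H3P] := determined_family
  (fun u : 'I_k * {ffun 'I_k -> 'I_3} => determined_sign_count (h u.1) 1 (sign_conditions u.2)).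
have [H4 H4P] := determined_family
  (fun u : {set 'I_k} * {ffun 'I_k -> 'I_3} => determined_sign_count (bounding_map u.1) 1 (sign_conditions u.2)).
exists (H1 ++ H2 ++ H3 ++ H4) => R L phi psi.
move=> /same_signs_cat[/H1P sizeE /same_signs_cat[/H2P leadE /same_signs_cat[/H3P count1 /H4P count2]]].
move=> theta.
have /choice[s sP] : forall i, exists j, sgz (map_poly psi (h i)).[theta] = sign3 j.
  by move=> i; exact: sign3_sgz.
pose sigma := [ffun i => s i].
have sigmaP i : sgz (map_poly psi (h i)).[theta] = sign3 (sigma i) by rewrite ffunE.
have from_count (p : {poly D}) x : map_poly psi p != 0 -> root (map_poly psi p) x ->
    (forall i, sgz (map_poly psi (h i)).[x] = sign3 (sigma i)) ->
    map_poly phi p != 0 ->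
    sign_count p 1 (sign_conditions sigma) phi = sign_count p 1 (sign_conditions sigma) psi ->
    exists y : R, forall i, sgz (map_poly phi (h i)).[y] = sgz (map_poly psi (h i)).[theta].
  move=> p0 px xs p0' E; have : sign_count p 1 (sign_conditions sigma) psi != 0.
    by apply/sign_count_gt0P => //; exists x => // _ /mapP[i _ ->] /=.
  rewrite -E => /(sign_count_gt0P _ p0')[y _ yP]; exists y => i.
  by rewrite (yP (h i, sign3 (sigma i))) ?sigmaP // map_f // mem_enum.
have zeroE i : (map_poly phi (h i) == 0) = (map_poly psi (h i) == 0).
  by rewrite -!size_poly_eq0 sizeE.
have [[i0 hi0 ri0]|nroot] := pselect (exists2 i, map_poly psi (h i) != 0 & root (map_poly psi (h i)) theta).
  apply: (from_count (h i0) theta) => //; first by rewrite zeroE.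
  exact: (count1 (i0, sigma)).
pose S : {set 'I_k} := [set i | map_poly psi (h i) != 0]%SET.
have S_sigma i : i \in S -> sign3 (sigma i) != 0.
  rewrite inE -sigmaP sgz_eq0 => hi; apply: contra_notN nroot => r.
  by exists i.
have signed_pos (K : rcfType) (chi : {rmorphism D -> K}) (y : K) :
   (forall i, i \notin S -> map_poly chi (h i) = 0) ->
   (\big[andb/true]_(q <- signed_maps chi S sigma) (0 < q.[y])) <->
   forall i, sgz (map_poly chi (h i)).[y] = sign3 (sigma i).
  move=> notS; rewrite big_all; split=> [/allP pos i|sg].
    have [iS|iS] := boolP (i \in S); last first.
      rewrite notS // horner0 sgz0 -sigmaP.
      by move: iS; rewrite inE negbK => /eqP ->; rewrite horner0 sgz0.
    apply/eqP; rewrite -sign3_mul_gt0 ?S_sigma // -hornerZ; apply: pos.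
    by rewrite inE; apply/orP; right; apply/mapP; exists i; rewrite ?mem_enum.
  apply/allP => q; rewrite inE => /orP[/eqP->|/mapP[i]].
    by rewrite hornerD hornerXn hornerC ltr_wpDl ?sqr_ge0.
  rewrite mem_enum => iS ->.
  by rewrite hornerZ sign3_mul_gt0 ?S_sigma // sg.
have notS_psi i : i \notin S -> map_poly psi (h i) = 0.
  by rewrite inE negbK => /eqP.
have notS_phi i : i \notin S -> map_poly phi (h i) = 0.
  by move=> /notS_psi /eqP; rewrite -zeroE => /eqP.
have from_pos (y : R) : (\big[andb/true]_(q <- signed_maps phi S sigma) (0 < q.[y])) ->
    exists y : R, forall i, sgz (map_poly phi (h i)).[y] = sgz (map_poly psi (h i)).[theta].
  by move=> /(signed_pos _ _ _ notS_phi) sg; exists y => i; rewrite sg sigmaP.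
have lead_transfer (e : nat -> bool) :
  \big[andb/true]_(q <- signed_maps psi S sigma) (0 < (-1) ^+ (e (size q)) * lead_coef q) ->
  \big[andb/true]_(q <- signed_maps phi S sigma) (0 < (-1) ^+ (e (size q)) * lead_coef q).
  have lead1 (K : rcfType) : lead_coef ('X^2 + 1 : {poly K}) = 1.
    by rewrite lead_coefDl ?lead_coefXn // size_polyXn size_poly1.
  rewrite !big_all /= !size_sqrX_add1 !lead1; case: (e 3); rewrite ?expr0 ?expr1 ?mulN1r ?oppr_gt0 ?ltr10 //.
  rewrite !mulr1 !ltr01 /= => /allP pos; apply/allP => _ /mapP[i iS ->].
  have := pos _ (map_f _ iS); rewrite mem_enum in iS.
  have s0 (K : rcfType) : ((sign3 (sigma i))%:~R : K) != 0 by rewrite intr_eq0 S_sigma.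
  rewrite !size_scale ?s0 // -!mul_polyC !lead_coefM !lead_coefC !sizeE.
  have gt0E (K : rcfType) (z : K) : (0 < z) = (sgz z == 1) by rewrite sgz_cp0.
  by rewrite !gt0E !sgzM leadE !sgzX !sgzN1 !sgz_int.
have : exists x : L, \big[andb/true]_(q <- signed_maps psi S sigma) (0 < q.[x]).
  by exists theta; apply/(signed_pos _ _ _ notS_psi) => i; rewrite sigmaP.
move=> /bounding_polyP[pos|pos|[x /andP[bx xpos]]].
- have [|y yP] := (bounding_polyP (signed_maps phi S sigma)).1.
    constructor 1; have := lead_transfer (fun _ => false).
    by under eq_bigr do rewrite mul1r; move/(_ pos); under eq_bigr do rewrite mul1r.
  exact: from_pos yP.
- have [|y yP] := (bounding_polyP (signed_maps phi S sigma)).1.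
    constructor 2; have := lead_transfer (fun m => odd m.-1).
    under eq_bigr do rewrite signr_odd.
    by move/(_ pos); under eq_bigr do rewrite signr_odd.
  exact: from_pos yP.
have boundE : exists2 c : L, c != 0 &
    bounding_poly (signed_maps psi S sigma) = c *: map_poly psi (bounding_map S).
  exists (\prod_(i in S) (sign3 (sigma i))%:~R).
    by apply/prodf_neq0 => i iS; rewrite intr_eq0 S_sigma.
  rewrite /bounding_poly /signed_maps /bounding_map big_cons big_map big_enum /=.
  under eq_bigr do rewrite -mul_polyC.
  rewrite big_split /= -rmorph_prod mul_polyC -scalerAr derivZ -deriv_map.
  by rewrite rmorphM rmorph_prod rmorphD rmorph1 /= map_polyXn.
have map_bound_neq0 (K : rcfType) (chi : {rmorphism D -> K}) :
    (forall i, i \in S -> map_poly chi (h i) != 0) -> map_poly chi (bounding_map S) != 0.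
  move=> nz; rewrite -size_poly_gt0 -deriv_map size_deriv.
  rewrite rmorphM rmorph_prod rmorphD rmorph1 /= map_polyXn.
  have P0 : \prod_(i in S) map_poly chi (h i) != 0 by apply/prodf_neq0 => i /nz.
  rewrite size_mul // ?size_sqrX_add1; last by rewrite -size_poly_gt0 size_sqrX_add1.
  by move: P0; rewrite -size_poly_gt0 => /prednK <-.
have [c c0 bE] := boundE.
apply: (from_count (bounding_map S) x) => //.
- by apply: map_bound_neq0 => i; rewrite inE.
- by move: bx; rewrite bE hornerZ mulf_eq0 (negPf c0).
- exact/(signed_pos _ _ _ notS_psi).
- by apply: map_bound_neq0 => i; rewrite inE -zeroE.
- exact: (count2 (S, sigma)).
Qed.
End Step.

Lemma mpoly_rmorphism_eq (n : nat) (B : nzRingType) (S : nzRingType)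
    (F G : {rmorphism {mpoly B[n]} -> S}) :
  (forall c, F c%:MP = G c%:MP) -> (forall i, F 'X_i = G 'X_i) -> F =1 G.
Proof.
move=> FC FX p; rewrite [p]mpolyE !rmorph_sum; apply: eq_bigr => m _.
rewrite -mul_mpolyC !rmorphM FC; congr (_ * _); rewrite mpolyXE_id !rmorph_prod.
by apply: eq_bigr => i _; rewrite !rmorphXn FX.
Qed.

Lemma mmap_muni (n : nat) (B : comNzRingType) (S : comNzRingType)
    (beta : {rmorphism B -> S}) (u : 'I_n -> S) (y : S) (w : 'I_n.+1 -> S) p :
  (forall i, w (widen_ord (leqnSn n) i) = u i) -> w ord_max = y ->
  mmap beta w p = (map_poly (mmap beta u) (muni p)).[y].
Proof.
move=> wu wy.
pose G : {rmorphism {mpoly B[n.+1]} -> S} :=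
  horner_eval y \o map_poly (mmap beta u) \o @muni n B.
rewrite -[RHS]/(G p); apply: mpoly_rmorphism_eq => [c|i].
  rewrite [LHS]mmapC /G /= muniC map_polyC /horner_eval hornerC. by rewrite [RHS]mmapC.
rewrite [LHS]mmapX mmap1U /G /=.
have -> : muni 'X_i = if unlift ord_max i is Some j then ('X_j)%:P else 'X :> {poly {mpoly B[n]}}.
  rewrite /muni mmapX mmap1U; case: splitP => [j ij|j ij].
    have -> : i = lift ord_max j by apply/val_inj; rewrite /= /bump leqNgt ltn_ord; exact: ij.
    by rewrite liftK.
  have -> : i = ord_max by apply/val_inj => /=; have := ij; rewrite ord1 addn0.
  by rewrite unlift_none.
case: unliftP => [j ->|->].
  rewrite map_polyC /horner_eval hornerC /= mmapX mmap1U -wu.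
  by congr (w _); apply/val_inj; rewrite /= /bump leqNgt ltn_ord.
by rewrite map_polyX /horner_eval hornerX wy.
Qed.

(** The coefficients in B have the same signs in R and in L. The variables are
eliminated from the last one on, and the coordinates of the point over R are
found in the opposite order. *)
Lemma sign_transfer (B : comNzRingType) (R L : rcfType)
    (beta : {rmorphism B -> R}) (beta' : {rmorphism B -> L}) :
  (forall b, sgz (beta b) = sgz (beta' b)) ->
  forall n k (h : 'I_k -> {mpoly B[n]}) (v : 'I_n -> L),
    exists u : 'I_n -> R, forall i, sgz (mmap beta u (h i)) = sgz (mmap beta' v (h i)).
Proof.
move=> bb'; elim=> [|n IHn] k h v.
  exists (fun=> 0) => i.
  have -> : h i = ((h i)@_0)%:MP.
    by apply/mpolyP => m; rewrite mcoeffC; have -> : m = 0%MM by [apply/mnmP; case]; rewrite eqxx mulr1.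
  by rewrite !mmapC bb'.
have [H HP] := sign_transfer_step (fun i => muni (h i)).
have [u uP] := IHn _ (fun i : 'I_(size H) => H`_i) (fun i => v (widen_ord (leqnSn n) i)).
set v' := (fun i => v _) in uP.
have S : @same_signs {mpoly B[n]} H R L (mmap beta u) (mmap beta' v').
  move=> a aH; have ia : (index a H < size H)%N by rewrite index_mem.
  by have := uP (Ordinal ia); rewrite /= nth_index.
have [y yP] := HP _ _ _ _ S (v ord_max).
pose w (i : 'I_n.+1) := if unlift ord_max i is Some j then u j else y.
exists w => i; rewrite (mmap_muni beta' (u := v') (y := v ord_max)) //.
rewrite (mmap_muni beta (u := u) (y := y)) ?yP // /w ?unlift_none // => j.
have -> : widen_ord (leqnSn n) j = lift ord_max j by apply/val_inj; rewrite /= /bump leqNgt ltn_ord.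
by rewrite liftK.
Qed.

(** * The real Nullstellensatz *)

Lemma mpoly_code (n : nat) (B : nzRingType) (code : B -> nat) :
  injective code -> exists code' : {mpoly B[n]} -> nat, injective code'.
Proof.
move=> code_inj; exists (fun p => pickle [seq (m, code p@_m) | m <- msupp p]) => p q.
move=> /(pcan_inj pickleK) E.
have ms : msupp p = msupp q.
  have fstE r : [seq u.1 | u <- [seq (m, code r@_m) | m <- msupp r]] = msupp r.
    by rewrite -map_comp map_id.
  by rewrite -[LHS]fstE E fstE.
rewrite [p]mpolyE [q]mpolyE -ms; apply: eq_big_seq => m mp; congr (_ *: _).
by move: E; rewrite -ms => /eq_in_map /(_ m mp)[/code_inj].
Qed.

(** Finitely many polynomials over R come from integer polynomials in their
coefficients; this replaces R by a countable ring. *)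
Lemma mpoly_int_lift (R : comNzRingType) (n k : nat) (G : 'I_k -> {mpoly R[n]}) :
  exists (m : nat) (c : 'I_m -> R), forall j, exists P : {mpoly {mpoly int[m]}[n]},
    map_mpoly (mmap (intmul 1) c) P = G j.
Proof.
pose cs := flatten [seq [seq (G j)@_m | m <- msupp (G j)] | j <- enum 'I_k].
exists (size cs), (fun i => cs`_i) => j.
have /choice[f fP] : forall r, exists b : {mpoly int[size cs]}, r \in cs ->
    mmap (intmul 1) (fun i : 'I_(size cs) => cs`_i) b = r.
  move=> r; have [rc|] := boolP (r \in cs); last by exists 0.
  have ir : (index r cs < size cs)%N by rewrite index_mem.
  by exists 'X_(Ordinal ir) => _; rewrite mmapX mmap1U /= nth_index.
exists (\sum_(m <- msupp (G j)) f (G j)@_m *: 'X_[m]).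
rewrite rmorph_sum [RHS]mpolyE; apply: eq_big_seq => m mp.
rewrite /= map_mpolyZ map_mpolyX /= fP //; apply/flattenP.
exists [seq (G j)@_m | m <- msupp (G j)]; last by apply/mapP; exists m.
by apply/mapP; exists j; rewrite ?mem_enum.
Qed.

Lemma meval_map_mpoly (n : nat) (B R : comNzRingType) (beta : {rmorphism B -> R})
    (u : 'I_n -> R) (p : {mpoly B[n]}) :
  (map_mpoly beta p).@[u] = mmap beta u p.
Proof.
pose F : {rmorphism {mpoly B[n]} -> R} := meval u \o map_mpoly beta.
rewrite -[LHS]/(F p); apply: mpoly_rmorphism_eq => [c|i].
  by rewrite /F /= map_mpolyC mevalC [RHS]mmapC.
by rewrite /F /= map_mpolyX mevalXU [RHS]mmapX mmap1U.
Qed.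

Lemma prime_cone_preim (A D : comNzRingType) (pi : {rmorphism D -> A}) (T : set A) :
  prime_cone T -> prime_cone (pi @^-1` T).
Proof.
move=> coneT; have [[TD TM Tsq] Ttot TN1 Tpr] := coneT; split.
- split=> [x y Tx Ty|x y Tx Ty|x] /=; rewrite ?rmorphD ?rmorphM ?rmorphXn.
  + exact: TD.
  + exact: TM.
  + exact: Tsq.
- by move=> x /=; rewrite rmorphN.
- by rewrite /= rmorphN rmorph1.
- by move=> x y; rewrite /support /= !rmorphN rmorphM; exact: Tpr.
Qed.

Section RealNullstellensatz.
Variables (R : rcfType) (n n1 : nat) (g : 'I_n1 -> {mpoly R[n]}).
Implicit Types (p q : {mpoly R[n]}).

Definition sos_mod : set {mpoly R[n]} :=
  [set p | exists (s : seq {mpoly R[n]}) (h : 'I_n1 -> {mpoly R[n]}),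
     p = \sum_(r <- s) r ^+ 2 + \sum_i g i * h i].

Lemma sos_mod_preorder : preorder sos_mod.
Proof.
split.
- move=> _ _ [s [h ->]] [s' [h' ->]]; exists (s ++ s'), (fun i => h i + h' i).
  have -> : \sum_i g i * (h i + h' i) = \sum_i g i * h i + \sum_i g i * h' i.
    by rewrite -big_split; apply: eq_bigr => i _; rewrite mulrDr.
  by rewrite big_cat /=; ring.
- move=> _ _ [s [h ->]] [s' [h' ->]].
  set S := \sum_(_ <- s) _; set S' := \sum_(_ <- s') _.
  set I := \sum_i _; set I' := \sum_i _.
  exists [seq r * r' | r <- s, r' <- s'], (fun i => h i * S' + S * h' i + h i * I').
  have -> : \sum_(r <- [seq r * r' | r <- s, r' <- s']) r ^+ 2 = S * S'.
    rewrite big_allpairs_dep /S big_distrl; apply: eq_bigr => r _.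
    by rewrite /S' big_distrr; apply: eq_bigr => r' _; rewrite exprMn.
  have -> : \sum_i g i * (h i * S' + S * h' i + h i * I') = I * S' + S * I' + I * I'.
    have E : I * S' + S * I' + I * I' =
        \sum_i ((g i * h i) * S' + S * (g i * h' i) + (g i * h i) * I').
      by rewrite !big_split /= -!mulr_suml -mulr_sumr.
    by rewrite E; apply: eq_bigr => i _; ring.
  by ring.
- move=> x; exists [:: x], (fun=> 0); rewrite big_seq1 big1 ?addr0 // => i _.
  by rewrite mulr0.
Qed.

Lemma sos_mod_gen i p : sos_mod (g i * p).
Proof.
exists [::], (fun j => if j == i then p else 0).
rewrite big_nil add0r (bigD1 i) //= eqxx big1 ?addr0 // => j /negbTE ->.
by rewrite mulr0.
Qed.

(** A prime cone T that contains the sums of squares modulo g and avoids the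
elements -q^(2m) would give a point over a real closed field L where g vanishes
and q does not. The constants of R keep their sign in L, because a positive
constant is a square and its opposite is not in T; hence the point can be
transferred to R, against the hypothesis on q. *)
Theorem real_nullstellensatz q :
  (forall x, (forall i, (g i).@[x] = 0) -> q.@[x] = 0) ->
  exists m, sos_mod (- q ^+ (2 * m)).
Proof.
move=> gq; apply: contrapT => nex.
pose M := [set p | exists m, p = q ^+ (2 * m)].
have [|||m' [m ->] Tm|T [T0T coneT TM]] := @maximal_preorder _ sos_mod M sos_mod_preorder.
- by exists 0%N; rewrite muln0 expr0.
- by move=> _ _ [i ->] [j ->]; exists (i + j)%N; rewrite mulnDr exprD.
- move=> _ [m ->]; rewrite mulnC exprM; exact: preorder_sqr sos_mod_preorder.
- by apply: nex; exists m.
have pT := prime_cone_preorder coneT.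
have suppg i : support T (g i).
  split; apply: T0T; first by rewrite -[g i]mulr1; exact: sos_mod_gen.
  by rewrite -[g i]mulr1 -mulrN; exact: sos_mod_gen.
have nsuppq : ~ support T q.
  move=> [Tq TNq]; apply: (TM (q ^+ (2 * 1))); first by exists 1%N.
  by rewrite muln1 expr2 -mulrN; exact: preorderM.
(* The list of g extended by q. *)
pose G (j : 'I_n1.+1) := if unlift ord_max j is Some i then g i else q.
have [m [c /choice[P PG]]] := mpoly_int_lift G.
pose B := {mpoly int[m]}; pose D := {mpoly B[n]}.
pose beta : {rmorphism B -> R} := mmap (intmul 1) c.
pose pi : {rmorphism D -> {mpoly R[n]}} := map_mpoly beta.
have [codeB codeB_inj] := @mpoly_code m int _ (pcan_inj pickleK).
have [codeD codeD_inj] := @mpoly_code n B _ codeB_inj.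
have [L [chi chiT]] := real_closed_realization codeD_inj (prime_cone_preim pi coneT).
have {}chiT d : 0 <= chi d <-> T (pi d) by exact: chiT.
pose beta' : {rmorphism B -> L} := chi \o @mpolyC n B.
pose v i := chi 'X_i.
have chiE d : chi d = mmap beta' v d.
  apply: mpoly_rmorphism_eq => [b|i]; first by rewrite [RHS]mmapC.
  by rewrite [RHS]mmapX mmap1U.
have posT (r : R) : 0 <= r -> T r%:MP.
  move=> r0; rewrite -(sqr_sqrtr r0) rmorphXn; exact: preorder_sqr pT.
have piC b : pi b%:MP = (beta b)%:MP by rewrite [LHS]map_mpolyC.
have pos_beta b : 0 < beta b -> 0 < beta' b.
  move=> b0; rewrite lt_neqAle; apply/andP; split; last first.
    by apply/chiT; rewrite piC; exact: posT (ltW b0).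
  apply/negP => /eqP b'0; apply: (prime_coneN1 coneT).
  have TN : T (- (beta b)%:MP).
    by rewrite -piC -rmorphN; apply/chiT; rewrite rmorphN -[chi _]b'0 oppr0.
  have -> : -1 = ((beta b)^-1)%:MP * - (beta b)%:MP :> {mpoly R[n]}.
    by rewrite mulrN -mpolyCM mulVf ?gt_eqF.
  by apply: (preorderM pT) => //; apply: posT; rewrite invr_ge0 ltW.
have sign_beta b : sgz (beta b) = sgz (beta' b).
  case: (sgzP (beta b)) => [b0|b0|b0].
  - apply/esym/eqP; rewrite sgz_eq0 eq_le; apply/andP; split.
      have -> : (beta' b <= 0) = (0 <= chi (- b%:MP)) by rewrite rmorphN oppr_ge0.
      apply/chiT; rewrite rmorphN piC b0 mpolyC0 oppr0.
      exact: preorder0 pT.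
    by apply/chiT; rewrite piC b0 mpolyC0; exact: preorder0 pT.
  - by rewrite gtr0_sgz ?pos_beta.
  - rewrite ltr0_sgz // -oppr_gt0 -rmorphN; apply: pos_beta.
    by rewrite rmorphN oppr_gt0.
have [u uP] := sign_transfer sign_beta P v.
have {}uP j : sgz (G j).@[u] = sgz (chi (P j)).
  by rewrite chiE -uP -PG -[map_mpoly _ _]/(map_mpoly beta (P j)) meval_map_mpoly.
have chi0 j : (G j).@[u] = 0 <-> support T (G j).
  have piP : pi (P j) = G j by rewrite -PG.
  split=> [Gu|[TG TNG]].
    have : chi (P j) = 0 by apply/eqP; rewrite -sgz_eq0 -uP Gu sgz0.
    move=> c0; split; first by rewrite -piP; apply/chiT; rewrite c0.
    by rewrite -piP -rmorphN; apply/chiT; rewrite rmorphN c0 oppr0.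
  apply/eqP; rewrite -sgz_eq0 uP sgz_eq0 eq_le; apply/andP; split.
    by rewrite -oppr_ge0 -rmorphN; apply/chiT; rewrite rmorphN piP.
  by apply/chiT; rewrite piP.
apply: nsuppq; have Gmax : G ord_max = q by rewrite /G unlift_none.
rewrite -Gmax; apply/chi0; rewrite Gmax; apply: gq => i.
have GE : G (lift ord_max i) = g i by rewrite /G liftK.
by rewrite -GE; apply/chi0; rewrite GE.
Qed.

End RealNullstellensatz.

(** * Finite sets of points *)

Section Points.
Variables (R : realType) (n : nat).
Implicit Types (x y : 'I_n -> R) (s : seq ('I_n -> R)) (p : {mpoly R[n]}).

Lemma separate_points x y : x <> y -> exists p, p.@[x] = 0 /\ p.@[y] = 1.
Proof.
move=> xy; have [i xyi] : exists i, x i != y i.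
  apply: contrapT => nex; apply: xy; apply/funext => i.
  by apply/eqP; apply: contrapT => /negP xyi; apply: nex; exists i.
exists ((y i - x i)^-1 *: ('X_i - (x i)%:MP)).
rewrite !mevalZ !mevalB !mevalXU !mevalC subrr mulr0; split=> //.
by rewrite mulVf // subr_eq0 eq_sym.
Qed.

Lemma separate_point_seq s y : y \notin s ->
  exists p, {in s, forall x, p.@[x] = 0} /\ p.@[y] = 1.
Proof.
elim: s => [|x s IHs]; first by exists 1; rewrite meval1.
rewrite inE negb_or => /andP[yx /IHs[p [ps py]]].
have [|q [qx qy]] := @separate_points x y; first by apply/eqP; rewrite eq_sym.
exists (q * p); split; last by rewrite mevalM py qy mulr1.
by move=> z; rewrite inE mevalM => /orP[/eqP ->|/ps ->]; rewrite ?qx ?mul0r ?mulr0.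
Qed.

Lemma meval_eq0_decomp x p : p.@[x] = 0 ->
  exists c : 'I_n -> {mpoly R[n]}, p = \sum_i c i * ('X_i - (x i)%:MP).
Proof.
suff H : exists c : 'I_n -> {mpoly R[n]}, p - p.@[x]%:MP = \sum_i c i * ('X_i - (x i)%:MP).
  by move=> px; move: H; rewrite px mpolyC0 subr0.
pose P q := exists c : 'I_n -> {mpoly R[n]}, q - q.@[x]%:MP = \sum_i c i * ('X_i - (x i)%:MP).
have P0 r : P r%:MP.
  exists (fun=> 0); rewrite mevalC subrr big1 // => i _; by rewrite mul0r.
have PX i : P 'X_i.
  exists (fun j => (j == i)%:R); rewrite mevalXU (bigD1 i) //= eqxx mul1r big1 ?addr0 //.
  by move=> j /negbTE ->; rewrite mul0r.
have PD q r : P q -> P r -> P (q + r).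
  move=> [c cq] [d dr]; exists (fun i => c i + d i).
  under eq_bigr do rewrite mulrDl.
  by rewrite big_split /= -cq -dr mevalD mpolyCD; ring.
have PM q r : P q -> P r -> P (q * r).
  move=> [c cq] [d dr]; exists (fun i => c i * r + q.@[x]%:MP * d i).
  have -> : q * r - (q * r).@[x]%:MP =
    (q - q.@[x]%:MP) * r + q.@[x]%:MP * (r - r.@[x]%:MP).
    by rewrite mevalM mpolyCM; ring.
  rewrite cq dr mulr_suml mulr_sumr -big_split; apply: eq_bigr => i _ /=.
  by ring.
have PXn q k : P q -> P (q ^+ k).
  by move=> Pq; elim: k => [|k IH]; rewrite ?expr0 ?exprS; [exact: (P0 1)|exact: PM].
rewrite -/(P p) [p]mpolyE; apply: big_ind => //; first by rewrite -mpolyC0.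
move=> m _; rewrite -mul_mpolyC; apply: (PM) => //; rewrite mpolyXE_id.
by apply: big_ind => [||i _]; [exact: (P0 1)|exact: PM|exact: PXn].
Qed.

Lemma generated_ideal_sub (A B : set {mpoly R[n]}) :
  A `<=` B -> generated_ideal A `<=` generated_ideal B.
Proof. by move=> AB p [s sA ->]; exists s => // u /sA /AB. Qed.

Lemma generated_idealD (A : set {mpoly R[n]}) p q :
  generated_ideal A p -> generated_ideal A q -> generated_ideal A (p + q).
Proof.
move=> [s sA ->] [s' s'A ->]; exists (s ++ s'); last by rewrite big_cat.
by move=> u; rewrite mem_cat => /orP[/sA|/s'A].
Qed.

Lemma generated_ideal_sum (A : set {mpoly R[n]}) (I : Type) (r : seq I)
    (F : I -> {mpoly R[n]}) :
  (forall i, generated_ideal A (F i)) -> generated_ideal A (\sum_(i <- r) F i).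
Proof.
move=> AF; apply: (big_ind (generated_ideal A)) => //; last exact: generated_idealD.
by exists [::] => //; rewrite big_nil.
Qed.

Lemma generated_idealM (A : set {mpoly R[n]}) a p : A p -> generated_ideal A (a * p).
Proof.
move=> Ap; exists [:: (a, p)]; last by rewrite big_seq1.
by move=> u; rewrite inE => /eqP ->.
Qed.

Lemma generated_idealMl (A : set {mpoly R[n]}) a p :
  generated_ideal A p -> generated_ideal A (a * p).
Proof.
move=> [s sA ->]; rewrite mulr_sumr; exists [seq (a * u.1, u.2) | u <- s].
  by move=> _ /mapP[u /sA ? ->].
by rewrite big_map; apply: eq_bigr => u _; rewrite mulrA.
Qed.

(** The vanishing ideal of s together with w is the product of the ideal I of s
and the maximal ideal m of w. If p belongs to both and u in I takes the value 1
at w, then p = p (1 - u) + u p, with 1 - u and p in m. *)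
Lemma vanishing_ideal_finite_generators s : uniq s ->
  exists G : seq {mpoly R[n]}, {in G, forall g, {in s, forall x, g.@[x] = 0}} /\
    forall p, {in s, forall x, p.@[x] = 0} -> generated_ideal [set` G] p.
Proof.
elim: s => [_|w s IHs] /=.
  exists [:: 1]; split=> // p _; rewrite -[p]mulr1; apply: generated_idealM.
  by rewrite /= inE.
move=> /andP[ws /IHs[G [Gs Ggen]]].
pose lin i : {mpoly R[n]} := 'X_i - (w i)%:MP.
exists [seq g * lin i | g <- G, i <- enum 'I_n]; split.
  move=> _ /allpairsP[[g i] [/= gG _ ->]] x; rewrite inE mevalM => /orP[/eqP->|xs].
    by rewrite mevalB mevalXU mevalC subrr mulr0.
  by rewrite (Gs g gG x xs) mul0r.
move=> p ps; have [u [us uw]] := separate_point_seq ws.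
set GG := [set` _].
have prod a b : generated_ideal [set` G] a -> b.@[w] = 0 -> generated_ideal GG (a * b).
  move=> [l lG ->] /meval_eq0_decomp[c ->]; rewrite mulr_suml.
  have -> : \sum_(i <- l) i.1 * i.2 * (\sum_i c i * ('X_i - (w i)%:MP)) =
    \sum_(i <- l) (if i.2 \in G then i.1 * i.2 * (\sum_i c i * ('X_i - (w i)%:MP)) else 0).
    by apply: eq_big_seq => i il; rewrite (lG i il).
  apply: generated_ideal_sum => -[a1 g] /=; case: ifPn => gG; last first.
    by exists [::] => //; rewrite big_nil.
  rewrite -mulrA; apply: generated_idealMl; rewrite mulr_sumr.
  apply: generated_ideal_sum => i; rewrite mulrCA; apply: generated_idealM.
  by apply/allpairsP; exists (g, i); rewrite mem_enum.
have pw : p.@[w] = 0 by apply: ps; rewrite mem_head.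
have gp : generated_ideal [set` G] p by apply: Ggen => x xs; apply: ps; rewrite inE xs orbT.
have gu : generated_ideal [set` G] u by exact: Ggen.
have -> : p = p * (1 - u) + u * p by ring.
by apply: generated_idealD; apply: prod => //; rewrite mevalB meval1 uw subrr.
Qed.

Lemma dominating_constant s (a b : ('I_n -> R) -> R) :
  {in s, forall x, 0 <= a x} -> {in s, forall x, a x = 0 -> b x <= 0} ->
  exists2 c, 0 <= c & {in s, forall x, b x <= c * a x}.
Proof.
elim: s => [|x s IHs] a0 ab; first by exists 0.
have [||c c0 cs] := IHs.
- by move=> y ys; apply: a0; rewrite inE ys orbT.
- by move=> y ys; apply: ab; rewrite inE ys orbT.
have ax : 0 <= a x by apply: a0; rewrite mem_head.
exists (c + `|b x / a x|); first by rewrite addr_ge0.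
move=> y; rewrite inE => /orP[/eqP->|ys]; last first.
  apply: le_trans (cs y ys) _; rewrite ler_wpM2r ?lerDl // a0 // inE ys orbT //.
have [ax0|ax0] := eqVneq (a x) 0; first by rewrite ax0 mulr0 ab ?mem_head.
rewrite mulrDl (le_trans (ler_norm _)) // -[leLHS](divfK (x := a x)) //.
rewrite normrM normfV (ger0_norm ax) lerDr mulr_ge0 //.
Qed.

End Points.

(** * Nonnegative polynomials and the truncated preordering *)

Section Truncated.
Variables (R : realType) (n n1 n2 : nat).
Variables (g0 : 'I_n1 -> {mpoly R[n]}) (gp : 'I_n2 -> {mpoly R[n]}).
Implicit Types (p q r : {mpoly R[n]}) (t d : nat).

Local Notation tp := (truncated_preordering g0 gp).

Lemma deg_le_sub p t d : (msize p + d <= t)%N -> p \in deg_le (t%:Z - d%:Z).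
Proof.
move=> pt; rewrite unfold_in subzn; last exact: leq_trans (leq_addl _ _) pt.
rewrite /deg_bound leqW // leq_subRL // ?(leq_trans (leq_addl _ _) pt) //.
by rewrite addnC.
Qed.

Lemma sos_le0 k : @sos_le R n k 0.
Proof. by exists [::] => //; rewrite big_nil. Qed.

Lemma sos_leD k p q : sos_le k p -> sos_le k q -> sos_le k (p + q).
Proof.
move=> [s sk ->] [s' s'k ->]; exists (s ++ s'); last by rewrite big_cat.
by move=> u; rewrite mem_cat => /orP[/sk|/s'k].
Qed.

Lemma truncated_preorderingD t p q : tp t p -> tp t q -> tp t (p + q).
Proof.
move=> [h [s [hd sd ->]]] [h' [s' [h'd s'd ->]]].
exists (fun i => h i + h' i), (fun e => s e + s' e); split.
- by move=> i; rewrite rpredD.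
- by move=> e; exact: sos_leD.
- under [in RHS]eq_bigr do rewrite mulrDr.
  under [X in _ = _ + X]eq_bigr do rewrite mulrDr.
  by rewrite !big_split /= addrACA.
Qed.

Lemma truncated_preordering0 t : tp t 0.
Proof.
exists (fun=> 0), (fun=> 0); split.
- by move=> i; exact: rpred0.
- by move=> e; exact: sos_le0.
- by rewrite !big1 ?addr0 // => *; rewrite mulr0.
Qed.

Lemma truncated_preordering_equality t i p :
  p \in deg_le ((2 * t)%N%:Z - (mpdeg (g0 i))%:Z) -> tp t (g0 i * p).
Proof.
move=> pd; exists (fun j => if j == i then p else 0), (fun=> 0); split.
- by move=> j; case: eqP => [->//|_]; exact: rpred0.
- by move=> e; exact: sos_le0.
- rewrite [X in _ + X]big1 ?addr0 => [|e _]; last by rewrite mulr0.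
  by rewrite (bigD1 i) //= eqxx big1 ?addr0 // => j /negbTE ->; rewrite mulr0.
Qed.

Lemma truncated_preordering_gprod_sqr t e p :
  p \in deg_le (t%:Z - (uphalf (mpdeg (gprod gp e)))%:Z) -> tp t (gprod gp e * p ^+ 2).
Proof.
move=> pd; exists (fun=> 0), (fun e' => if e' == e then p ^+ 2 else 0); split.
- by move=> j; exact: rpred0.
- move=> e'; case: eqP => [->|_]; last exact: sos_le0.
  by exists [:: p]; rewrite ?big_seq1 // => u; rewrite inE => /eqP ->.
- rewrite [X in X + _]big1 ?add0r => [|i _]; last by rewrite mulr0.
  by rewrite (bigD1 e) //= eqxx big1 ?addr0 // => e' /negbTE ->; rewrite mulr0.
Qed.

Lemma gprod0 : gprod gp [ffun=> false] = 1.
Proof. by rewrite /gprod big1 // => j _; rewrite ffunE expr0. Qed.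

Lemma gprod1 j : gprod gp [ffun i => i == j] = gp j.
Proof.
rewrite /gprod (bigD1 j) //= ffunE eqxx expr1 big1 ?mulr1 // => i /negbTE ij.
by rewrite ffunE ij expr0.
Qed.

Lemma gprod_ge0 e x : feasible_set g0 gp x -> 0 <= (gprod gp e).@[x].
Proof.
move=> [_ gx]; rewrite rmorph_prod /=; apply: prodr_ge0 => j _.
by rewrite rmorphXn exprn_ge0 //; exact: gx.
Qed.

Lemma truncated_preordering_ge0 t p x :
  tp t p -> feasible_set g0 gp x -> 0 <= p.@[x].
Proof.
move=> [h [s [_ sd ->]]] Sx; rewrite mevalD !raddf_sum /=.
rewrite [X in X + _]big1 ?add0r => [|i _]; last by rewrite mevalM Sx.1 mul0r.
apply: sumr_ge0 => e _; rewrite mevalM mulr_ge0 ?gprod_ge0 //.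
have [l _ ->] := sd e; rewrite raddf_sum; apply: sumr_ge0 => r _ /=.
by rewrite rmorphXn sqr_ge0.
Qed.

(** The order t0 is the same for all eps. This is stable under sums, and the
generators of P_t(g) have it as soon as the degrees of their factors stay
bounded, however large the coefficients become as eps tends to 0. *)
Definition uniformly_preordered (F : R -> {mpoly R[n]}) :=
  exists t0, forall t, (t0 <= t)%N -> forall eps, 0 < eps -> tp t (F eps).

Definition bounded_degree (F : R -> {mpoly R[n]}) :=
  exists d, forall eps, (msize (F eps) <= d)%N.

Local Notation up := uniformly_preordered.
Local Notation bd := bounded_degree.

Lemma bounded_degree_cst p : bd (fun=> p).
Proof. by exists (msize p). Qed.

Lemma bounded_degreeD F G : bd F -> bd G -> bd (fun eps => F eps + G eps).
Proof.
move=> [d Fd] [d' Gd]; exists (maxn d d') => eps.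
by apply: leq_trans (msizeD_le _ _) _; rewrite geq_max !leq_max Fd Gd orbT.
Qed.

Lemma bounded_degreeM F G : bd F -> bd G -> bd (fun eps => F eps * G eps).
Proof.
move=> [d Fd] [d' Gd]; exists (d + d').+1 => eps.
apply: leq_trans (msizeM_le _ _) _.
by rewrite ltnS leq_add.
Qed.

Lemma bounded_degreeZ (c : R -> R) F : bd F -> bd (fun eps => c eps *: F eps).
Proof. by move=> [d Fd]; exists d => eps; exact: leq_trans (msizeZ_le _ _) (Fd eps). Qed.

Lemma bounded_degreeX F k : bd F -> bd (fun eps => F eps ^+ k).
Proof.
move=> Fd; elim: k => [|k IHk]; first exact: (bounded_degree_cst 1).
have [d dP] := bounded_degreeM Fd IHk; exists d => eps; by rewrite exprS.
Qed.

Lemma uniformly_preordered_ext F G : (forall eps, 0 < eps -> F eps = G eps) -> up F -> up G.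
Proof.
move=> FG [t0 H]; exists t0 => t t0t eps eps0.
by rewrite -FG //; exact: H.
Qed.

Lemma uniformly_preorderedD F G : up F -> up G -> up (fun eps => F eps + G eps).
Proof.
move=> [a Fa] [b Gb]; exists (maxn a b) => t; rewrite geq_max => /andP[a_t b_t].
by move=> eps eps0; apply: truncated_preorderingD; [exact: Fa|exact: Gb].
Qed.

Lemma uniformly_preordered_sum (I : Type) (s : seq I) (F : I -> R -> {mpoly R[n]}) :
  (forall i, up (F i)) -> up (fun eps => \sum_(i <- s) F i eps).
Proof.
move=> Fi; elim: s => [|i s IHs].
  by exists 0%N => t _ eps _; rewrite big_nil; exact: truncated_preordering0.
apply: (uniformly_preordered_ext _ (uniformly_preorderedD (Fi i) IHs)) => eps _.
by rewrite big_cons.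
Qed.

Lemma uniformly_preordered_equality i F : bd F -> up (fun eps => g0 i * F eps).
Proof.
move=> [d Fd]; exists (d + mpdeg (g0 i))%N => t dt eps _.
apply: truncated_preordering_equality; apply: deg_le_sub.
by have := Fd eps; lia.
Qed.

Lemma uniformly_preordered_gprod_sqr (e : {ffun 'I_n2 -> bool}) F (c : R -> R) :
  bd F -> (forall eps, 0 < eps -> 0 <= c eps) ->
  up (fun eps => c eps *: (gprod gp e * F eps ^+ 2)).
Proof.
move=> [d Fd] c0; exists (d + uphalf (mpdeg (gprod gp e)))%N => t dt eps eps0.
have -> : c eps *: (gprod gp e * F eps ^+ 2) =
    gprod gp e * (Num.sqrt (c eps) *: F eps) ^+ 2.
  by rewrite exprZn sqr_sqrtr ?c0 // scalerAr.
apply: truncated_preordering_gprod_sqr; apply: deg_le_sub.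
apply: leq_trans dt; rewrite leq_add2r.
exact: leq_trans (msizeZ_le _ _) (Fd eps).
Qed.

Lemma uniformly_preordered_sqr F (c : R -> R) :
  bd F -> (forall eps, 0 < eps -> 0 <= c eps) -> up (fun eps => c eps *: F eps ^+ 2).
Proof.
move=> Fd c0; have := @uniformly_preordered_gprod_sqr [ffun=> false] F c Fd c0.
by apply: uniformly_preordered_ext => eps _; rewrite gprod0 mul1r.
Qed.

Lemma complete_square (d c : R) p :
  d *: (1 + c *: p) ^+ 2 = d%:MP + (d * c *+ 2) *: p + (d * c ^+ 2) *: p ^+ 2.
Proof.
rewrite sqrrD expr1n mul1r exprZn 2!scalerDr scalerMnl !scalerA mulrnAr.
by rewrite -[d *: 1]mul_mpolyC mulr1.
Qed.

(** Each step writes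
  delta + F = delta/2 (1 + F/delta)^2 + (delta/2 - F^2 / (2 delta))
and goes on with the second summand, so that F is replaced by a multiple of
F^2. The exponent of F doubles while the degrees remain independent of eps. *)
Lemma complete_square_iter k (delta : R -> R) F :
  (forall eps, 0 < eps -> 0 < delta eps) -> bd F ->
  exists c : R -> R, (forall eps, 0 < eps -> 0 <= c eps) /\
    up (fun eps => (delta eps)%:MP + F eps + c eps *: F eps ^+ (2 ^ k.+1)).
Proof.
elim: k delta F => [|k IHk] delta F d0 Fd.
  exists (fun eps => (4 * delta eps)^-1); split.
    by move=> eps /d0 ?; rewrite invr_ge0 mulr_ge0 // ltW.
  have H : bd (fun eps => 1 + (2 * delta eps)^-1 *: F eps).
    by apply: bounded_degreeD; [exact: bounded_degree_cst|exact: bounded_degreeZ].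
  apply: (uniformly_preordered_ext _ (uniformly_preordered_sqr H (c := delta) _)); last by move=> eps /d0/ltW.
  move=> eps /d0 e0; have d_neq0 : delta eps != 0 by rewrite gt_eqF.
  rewrite complete_square expn1; congr (_ + _ + _ *: _); last by field.
  by rewrite -[RHS]scale1r; congr (_ *: _); field.
have [||c [c0 IH]] := IHk (fun eps => delta eps / 2) (fun eps => - (2 * delta eps)^-1 *: F eps ^+ 2).
- by move=> eps /d0 ?; rewrite divr_gt0.
- by apply: bounded_degreeZ; exact: bounded_degreeX.
exists (fun eps => c eps * ((2 * delta eps)^-1) ^+ (2 ^ k.+1)); split.
  move=> eps e0; rewrite mulr_ge0 ?c0 // exprn_ge0 // invr_ge0 mulr_ge0 // ltW //.
  exact: d0.
have H : bd (fun eps => 1 + (delta eps)^-1 *: F eps).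
  by apply: bounded_degreeD; [exact: bounded_degree_cst|exact: bounded_degreeZ].
have S := uniformly_preordered_sqr H (c := fun eps => delta eps / 2).
apply: (uniformly_preordered_ext _ (uniformly_preorderedD (S _) IH)); last by move=> eps /d0 ?; rewrite divr_ge0 // ltW.
move=> eps /d0 e0; have d_neq0 : delta eps != 0 by rewrite gt_eqF.
rewrite complete_square exprZn -exprM -expnS.
have -> : (- (2 * delta eps)^-1) ^+ (2 ^ k.+1) = (2 * delta eps)^-1 ^+ (2 ^ k.+1).
  by rewrite exprNn [in (-1) ^+ _]expnS exprM sqrrN expr1n expr1n mul1r.
rewrite scalerA.
have -> : delta eps / 2 * (delta eps)^-1 *+ 2 = 1 by field.
have -> : delta eps / 2 * (delta eps)^-1 ^+ 2 = (2 * delta eps)^-1 by field.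
rewrite scale1r scaleNr.
have -> : (delta eps)%:MP = (delta eps / 2)%:MP + (delta eps / 2)%:MP :> {mpoly R[n]}.
  by rewrite -mpolyCD; congr (_%:MP); field.
by ring.
Qed.

(** At a point x of the real variety, the value of p is matched by
p(x) u^2 if it is nonnegative, where u is 1 at x and 0 at the other points, and
otherwise by (p(x) / g(x)) g u^2 for a constraint g that is negative at x. *)
Lemma nonneg_uniformly_preordered p :
  finite_set (real_variety g0) -> (forall x, feasible_set g0 gp x -> 0 <= p.@[x]) ->
  up (fun eps => p + eps%:MP).
Proof.
move=> /finite_seqP[s0 V0] p_ge0; pose s := undup s0.
have Vs x : (forall i, (g0 i).@[x] = 0) <-> x \in s.
  by rewrite mem_undup -[X in X <-> _]/(real_variety g0 x) V0.
have /choice[u uP] : forall x, exists u : {mpoly R[n]},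
    {in s, forall y, u.@[y] = (y == x)%:R}.
  move=> x; have [|u [us ux]] := @separate_point_seq R n (rem x s) x.
    by rewrite mem_rem_uniq ?undup_uniq // inE eqxx.
  exists u => y ys; have [->//|yx] := eqVneq y x.
  by rewrite us // mem_rem_uniq ?undup_uniq // inE yx.
have /choice[w wP] : forall x, exists w : R * {ffun 'I_n2 -> bool},
    x \in s -> 0 <= w.1 /\ w.1 * (gprod gp w.2).@[x] = p.@[x].
  move=> x; have [px|px] := leP 0 p.@[x].
    by exists (p.@[x], [ffun=> false]) => _; rewrite gprod0 meval1 mulr1.
  have [[j gx]|nex] := pselect (exists j, (gp j).@[x] < 0).
    exists (p.@[x] / (gp j).@[x], [ffun i => i == j]) => _; rewrite gprod1 divfK ?lt_eqF //.
    by split=> //; rewrite ltW // nmulr_rgt0 ?invr_lt0.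
  exists (0, [ffun=> false]) => /Vs xV; suff : 0 <= p.@[x] by rewrite leNgt px.
  apply: p_ge0; split=> // j; rewrite leNgt; apply/negP => gx; apply: nex.
  by exists j.
pose sigma x := (w x).1 *: (gprod gp (w x).2 * u x ^+ 2).
(* The guard makes every summand, and not only those indexed by s, an
   element of the preordering. *)
pose q := p - \sum_(x <- s) (if x \in s then sigma x else 0).
have qV x : (forall i, (g0 i).@[x] = 0) -> q.@[x] = 0.
  move=> /Vs xs; rewrite mevalB (rmorph_sum (meval x)) (bigD1_seq x) ?undup_uniq //= xs.
  rewrite big1_seq ?addr0; last first.
    move=> y /andP[yx ys]; rewrite ys mevalZ mevalM rmorphXn /= uP //.
    by rewrite eq_sym (negPf yx) expr0n mulr0 mulr0.
  have [_ wx] := wP x xs.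
  by rewrite mevalZ mevalM rmorphXn /= uP // eqxx expr1n mulr1 wx subrr.
have [m [l [h qm]]] := real_nullstellensatz qV.
have mk : (m <= 2 ^ m)%N by rewrite ltnW // ltn_expl.
(* The exponent 2 m is raised to a power of two, as squares are completed. *)
pose e := (2 ^ m - m)%N.
have [c [c0 upq]] := @complete_square_iter m id (fun=> q) (fun _ => id) (bounded_degree_cst q).
have qN : - q ^+ (2 ^ m.+1) = \sum_(r <- l) (q ^+ e * r) ^+ 2 + \sum_i g0 i * (q ^+ (2 * e) * h i).
  have -> : (2 ^ m.+1 = 2 * e + 2 * m)%N by rewrite -mulnDr subnK // expnS.
  rewrite exprD -mulrN qm mulrDr !mulr_sumr; congr (_ + _); apply: eq_bigr => r _.
    by rewrite exprMn -exprM mulnC.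
  by rewrite mulrCA.
have up1 : up (fun eps => \sum_(x <- s) (if x \in s then sigma x else 0)).
  apply: (@uniformly_preordered_sum _ s (fun x _ => if x \in s then sigma x else 0)) => x.
  case: ifP => xs; last by exists 0%N => t _ ? _; exact: truncated_preordering0.
  apply: (@uniformly_preordered_gprod_sqr (w x).2 (fun=> u x) (fun=> (w x).1)); first exact: bounded_degree_cst.
  by move=> _ _; have [] := wP x xs.
have up2 : up (fun eps => \sum_(r <- l) c eps *: (q ^+ e * r) ^+ 2).
  by apply: uniformly_preordered_sum => r; apply: uniformly_preordered_sqr => //; exact: bounded_degree_cst.
have up3 : up (fun eps => \sum_i g0 i * (c eps *: (q ^+ (2 * e) * h i))).
  apply: uniformly_preordered_sum => i; apply: uniformly_preordered_equality.
  by apply: bounded_degreeZ; exact: bounded_degree_cst.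
have up_all := uniformly_preorderedD up1
  (uniformly_preorderedD upq (uniformly_preorderedD up2 up3)).
apply: uniformly_preordered_ext up_all => eps _.
have -> : \sum_(r <- l) c eps *: (q ^+ e * r) ^+ 2 +
  \sum_i g0 i * (c eps *: (q ^+ (2 * e) * h i)) = - (c eps *: q ^+ (2 ^ m.+1)).
  rewrite -scalerN qN scalerDr !scaler_sumr; congr (_ + _).
  by apply: eq_bigr => i _; rewrite -scalerAr.
by rewrite /q; ring.
Qed.

End Truncated.

(** * Feasible forms and their moment kernels *)

Section Forms.
Variables (R : realType) (n n1 n2 : nat).
Variables (g0 : 'I_n1 -> {mpoly R[n]}) (gp : 'I_n2 -> {mpoly R[n]}).
Variable t : nat.
Implicit Types (L : polydual n R t).

Local Notation tp := (truncated_preordering g0 gp).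

Lemma eval_linear (x : 'I_n -> R) :
  linear (fun p : polyle n R (2 * t)%N => (p : {mpoly R[n]}).@[x] : R^o).
Proof. by move=> c p q /=; rewrite mevalD mevalZ. Qed.

Definition eval_form (x : 'I_n -> R) : polydual n R t :=
  linfun (fun p : polyle n R (2 * t)%N => (p : {mpoly R[n]}).@[x] : R^o).

Lemma eval_formE x p : eval_form x p = (p : {mpoly R[n]}).@[x].
Proof.
pose E := HB.pack_for {linear polyle n R (2 * t)%N -> R^o}
  (fun p : polyle n R (2 * t)%N => (p : {mpoly R[n]}).@[x] : R^o)
  (GRing.isLinear.Build R _ _ _ _ (eval_linear x)).
exact: (lfunE E).
Qed.

Lemma eval_form_feasible x : feasible_set g0 gp x -> feasible_form g0 gp t (eval_form x).
Proof.
move=> Sx; split=> [p tpp|]; rewrite eval_formE; last by rewrite /= meval1.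
exact: truncated_preordering_ge0 tpp Sx.
Qed.

Lemma formDZ L a (p q : polyle n R (2 * t)%N) :
  L (p + a *: q) = (L p : R) + a * (L q : R) :> R.
Proof. by rewrite addrC linearP addrC. Qed.

Definition midpoint_form L L' : polydual n R t := 2^-1 *: (L + L').

Lemma midpoint_formE L L' p :
  midpoint_form L L' p = 2^-1 * ((L p : R) + (L' p : R)) :> R.
Proof. by rewrite /midpoint_form scale_lfunE add_lfunE. Qed.

Lemma feasible_form_midpoint L L' :
  feasible_form g0 gp t L -> feasible_form g0 gp t L' ->
  feasible_form g0 gp t (midpoint_form L L').
Proof.
move=> [Lpos L1] [L'pos L'1]; split=> [p tpp|]; rewrite midpoint_formE.
  by rewrite mulr_ge0 ?invr_ge0 // addr_ge0 ?Lpos ?L'pos.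
by rewrite L1 L'1; field.
Qed.

(** This is where the uniformity in eps enters: for fixed t, let eps tend to 0. *)
Lemma feasible_form_ge0 L (p : polyle n R (2 * t)%N) : feasible_form g0 gp t L ->
  (forall eps, 0 < eps -> tp t ((p : {mpoly R[n]}) + eps%:MP)) -> 0 <= (L p : R).
Proof.
move=> [Lpos L1] ptp; apply/ler_addgt0Pr => eps eps0.
have := Lpos (p + eps *: polyle1 n R t); rewrite formDZ L1 mulr1; apply=> /=.
by rewrite -mul_mpolyC mulr1; exact: ptp.
Qed.

Lemma feasible_form_sqr L (p : polyle n R t) : feasible_form g0 gp t L ->
  0 <= (L (polyle_mul p p) : R).
Proof.
move=> [Lpos _]; apply: Lpos.
have -> : polyle_mul p p = gprod gp [ffun=> false] * (p : {mpoly R[n]}) ^+ 2 :> {mpoly R[n]}.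
  by rewrite gprod0 mul1r.
apply: truncated_preordering_gprod_sqr; rewrite gprod0 /mpdeg msize1 /= subr0.
exact: polyleP.
Qed.

Lemma mem_moment_ker L (p : polyle n R t) :
  (p \in lker (moment_map L)) <-> forall q, L (polyle_mul p q) = 0.
Proof.
rewrite memv_ker; split=> [/eqP p0 q|p0].
  by rewrite -moment_mapE p0 zero_lfunE.
by apply/eqP/lfunP => q; rewrite moment_mapE zero_lfunE p0.
Qed.

(** Cauchy-Schwarz: L((q + a p)^2) = L(q^2) + 2 a L(p q) is nonnegative for all a
when L(p^2) = 0, which forces L(p q) = 0. *)
Lemma moment_ker_sqr L (p : polyle n R t) : feasible_form g0 gp t L ->
  (p \in lker (moment_map L)) <-> L (polyle_mul p p) = 0.
Proof.
move=> feasL; rewrite mem_moment_ker; split=> [|p0 q]; first exact.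
pose b : R := L (polyle_mul p q); pose c : R := L (polyle_mul q q).
have expand (a : R) : 0 <= c + a * b *+ 2.
  have := feasible_form_sqr (q + a *: p) feasL.
  have -> : polyle_mul (q + a *: p) (q + a *: p) =
      polyle_mul q q + a *: polyle_mul p q + a *: polyle_mul p q + (a ^+ 2) *: polyle_mul p p.
    apply/val_inj => /=; rewrite expr2 -!mul_mpolyC mpolyCM; ring.
  by rewrite !formDZ p0 mulr0 addr0 -/b -/c mulr2n addrA.
have c0 : 0 <= c by have := expand 0; rewrite mul0r mul0rn addr0.
have [//|b0] := eqVneq b 0.
(* At this value of a the expression equals - c - 2, a negative number. *)
have := expand (- (c + 1) / b).
by rewrite divfK // -mulr_natr; lra.
Qed.

End Forms.

Section Optimal.
Variables (R : realType) (n n1 n2 : nat).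
Variables (g0 : 'I_n1 -> {mpoly R[n]}) (gp : 'I_n2 -> {mpoly R[n]}).
Variable t : nat.

(** The midpoint K of L and L' is again optimal, and its kernel is the intersection of
theirs because L(p^2) and L'(p^2) are nonnegative. The rank of L being maximal, the kernel
of K cannot be smaller than that of L. *)
Lemma optimal_ker_sub (f : polyle n R (2 * t)%N) (L L' : polydual n R t) :
  optimal_form g0 gp f L -> feasible_form g0 gp t L' -> (L' f : R) = L f ->
  forall p, p \in lker (moment_map L) -> p \in lker (moment_map L').
Proof.
move=> [feasL Lf Lmax] feasL' L'f p pL; pose K := midpoint_form L L'.
have feasK : feasible_form g0 gp t K by exact: feasible_form_midpoint.
have Kf : (K f : R)%:E = f_mu g0 gp f.
  by rewrite -Lf; congr (_%:E); rewrite midpoint_formE L'f; field.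
have kerK q : q \in lker (moment_map K) -> q \in lker (moment_map L) /\ q \in lker (moment_map L').
  move=> /(moment_ker_sqr q feasK).1; rewrite midpoint_formE => /eqP.
  rewrite mulf_eq0 invr_eq0 pnatr_eq0 /= paddr_eq0 ?(feasible_form_sqr _ feasL) ?(feasible_form_sqr _ feasL') //.
  by move=> /andP[/eqP H /eqP H']; split; [apply/(moment_ker_sqr q feasL)|apply/(moment_ker_sqr q feasL')].
have KL : (lker (moment_map K) <= lker (moment_map L))%VS by apply/subvP => q /kerK[].
suff : (lker (moment_map K) == lker (moment_map L))%VS.
  by rewrite eqEsubv => /andP[_ /subvP/(_ p pL)/kerK[]].
rewrite eqEdim KL /=; have := Lmax K feasK Kf.
have := limg_ker_dim (moment_map K) fullv; have := limg_ker_dim (moment_map L) fullv.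
by rewrite !capfv; lia.
Qed.

End Optimal.

(** * The relaxations at high order *)

Section Minimum.
Variables (R : realType) (n n1 n2 : nat).
Variables (g0 : 'I_n1 -> {mpoly R[n]}) (gp : 'I_n2 -> {mpoly R[n]}).
Implicit Types (f : {mpoly R[n]}).

Lemma feasible_set_seq : finite_set (real_variety g0) -> exists2 s : seq ('I_n -> R), uniq s &
  forall x, feasible_set g0 gp x <-> x \in s.
Proof.
move=> finV; have finS : finite_set (feasible_set g0 gp).
  by apply: sub_finite_set finV => x [].
have /finite_seqP[s sE] := finS; exists (undup s); first exact: undup_uniq.
by move=> x; rewrite mem_undup sE.
Qed.

Lemma minimum_reached f : finite_set (real_variety g0) -> feasible_set g0 gp !=set0 ->
  exists2 x, feasible_set g0 gp x &
    forall y, feasible_set g0 gp y -> f.@[x] <= f.@[y].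
Proof.
move=> finV [x0 Sx0]; have [s _ sS] := feasible_set_seq finV.
have : forall s : seq ('I_n -> R), s != [::] ->
    exists2 x, x \in s & {in s, forall y, f.@[x] <= f.@[y]}.
  elim=> // x [|y s'] IH _.
    by exists x; rewrite ?mem_head // => z; rewrite inE => /eqP ->.
  have [//|z zs zmin] := IH; have [xz|zx] := leP f.@[x] f.@[z].
    exists x; first exact: mem_head.
    by move=> w; rewrite inE => /orP[/eqP->//|/zmin]; exact: le_trans.
  exists z; first by rewrite inE zs orbT.
  by move=> w; rewrite inE => /orP[/eqP->|/zmin//]; exact: ltW.
move=> /(_ s)[|x xs xmin].
  by apply/negP => /eqP s0; move: Sx0; rewrite sS s0.
by exists x; [apply/sS|move=> y /sS; exact: xmin].
Qed.

Lemma f_star_minimum f x : feasible_set g0 gp x ->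
  (forall y, feasible_set g0 gp y -> f.@[x] <= f.@[y]) ->
  f_star g0 gp f = (f.@[x])%:E.
Proof.
move=> Sx xmin; apply/eqP; rewrite eq_le; apply/andP; split.
  by apply: ereal_inf_lbound; exists x.
by apply: le_ereal_inf_tmp => _ [y Sy <-]; rewrite lee_fin xmin.
Qed.

End Minimum.

Lemma common_threshold (I : eqType) (s : seq I) (P : I -> nat -> Prop) :
  (forall i, i \in s -> exists t0, forall t, (t0 <= t)%N -> P i t) ->
  exists t0, forall t, (t0 <= t)%N -> forall i, i \in s -> P i t.
Proof.
elim: s => [|i s IHs] Ps; first by exists 0%N.
have [a aP] := Ps i (mem_head _ _).
have [|b bP] := IHs; first by move=> j js; apply: Ps; rewrite inE js orbT.
exists (maxn a b) => t; rewrite geq_max => /andP[at_ bt] j.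
by rewrite inE => /orP[/eqP ->|]; [exact: aP|exact: bP].
Qed.

Theorem theorem6p6 (R : realType) (n n1 n2 : nat) (f : {mpoly R[n]})
    (g0 : 'I_n1 -> {mpoly R[n]}) (gp : 'I_n2 -> {mpoly R[n]}) :
  finite_set (real_variety g0) ->
  feasible_set g0 gp !=set0 ->
  exists t0 : nat, forall t : nat, (t0 <= t)%N ->
    exists2 ft : polyle n R (2 * t)%N, ft = f :> {mpoly R[n]} &
    [/\ [/\ f_sos g0 gp t f = f_mu g0 gp ft,
            f_mu g0 gp ft = f_star g0 gp f,
            (exists2 x, feasible_set g0 gp x & f_star g0 gp f = (f.@[x])%:E)
          & (exists2 L, feasible_form g0 gp t L &
               (L ft : R)%:E = f_mu g0 gp ft)]
      & forall L, optimal_form g0 gp ft L ->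
          generated_ideal (moment_ker L) =
          vanishing_ideal (minimizers g0 gp f)].
Proof.
move=> finV S0; have [xs Sxs xs_min] := minimum_reached f finV S0.
have fstar := f_star_minimum Sxs xs_min; set m := f.@[xs] in fstar.
have [s s_uniq sS] := feasible_set_seq gp finV.
pose smin := [seq x <- s | f.@[x] == m].
have sminP x : minimizers g0 gp f x <-> x \in smin.
  rewrite mem_filter /minimizers /= fstar; split=> [[/sS -> [->]]|/andP[/eqP-> /sS]//].
  by rewrite eqxx.
have [|G [Gmin Ggen]] := @vanishing_ideal_finite_generators R n smin.
  exact: filter_uniq.
have [t1 t1P] : uniformly_preordered g0 gp (fun eps => (f - m%:MP) + eps%:MP).
  apply: nonneg_uniformly_preordered => // x /xs_min.
  by rewrite mevalB mevalC subr_ge0.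
(* On S(g), h vanishes wherever f - m does, so C (f - m) >= h^2 for C large. *)
have dominate h : h \in G -> exists C, exists t0, forall t, (t0 <= t)%N ->
    (msize h <= t)%N /\ forall eps, 0 < eps ->
      truncated_preordering g0 gp t ((C *: (f - m%:MP) - h * h) + eps%:MP).
  move=> hG; have [||C C0 CP] := @dominating_constant R n s
      (fun x => f.@[x] - m) (fun x => h.@[x] ^+ 2).
  - by move=> x /sS /xs_min; rewrite subr_ge0.
  - move=> x xs' /eqP; rewrite subr_eq0 => /eqP fx.
    by rewrite (Gmin h hG x) ?expr0n // mem_filter fx eqxx.
  exists C; have [|t0 t0P] := @nonneg_uniformly_preordered R n n1 n2 g0 gp
      (C *: (f - m%:MP) - h * h) finV.
    move=> x /sS /CP; rewrite mevalB mevalZ mevalM mevalB mevalC -expr2.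
    by rewrite subr_ge0.
  exists (maxn (msize h) t0) => t; rewrite geq_max => /andP[ht t0t].
  by split=> //; exact: t0P.
have /choice[C CP] : forall h, exists c, h \in G -> exists t0, forall t, (t0 <= t)%N ->
    (msize h <= t)%N /\ forall eps, 0 < eps ->
      truncated_preordering g0 gp t ((c *: (f - m%:MP) - h * h) + eps%:MP).
  move=> h; have [/dominate[c cP]|hG] := boolP (h \in G); first by exists c.
  by exists 0.
have [t2 t2P] := common_threshold CP.
exists (maxn (msize f) (maxn t1 t2)) => t; rewrite !geq_max => /and3P[ft t1t t2t].
have ft_deg : f \in deg_le (2 * t)%N.
  by rewrite unfold_in /= (leq_trans ft) // leqW // leq_pmull.
pose F : polyle n R (2 * t)%N := PolyLe ft_deg; exists F => //.
have F_ge L : feasible_form g0 gp t L -> m <= (L F : R).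
  move=> feasL; have := @feasible_form_ge0 R n n1 n2 g0 gp t L (F + (- m) *: polyle1 n R t) feasL.
  rewrite formDZ feasL.2 mulr1 subr_ge0; apply=> eps eps0 /=.
  have -> : f + - m *: 1 = f - m%:MP by rewrite scaleNr -mul_mpolyC mulr1.
  exact: t1P.
have EF : (eval_form t xs F : R) = m by rewrite eval_formE.
(* The relaxed minimum is squeezed between m and the value of an evaluation. *)
have fmu : f_mu g0 gp F = m%:E.
  apply/eqP; rewrite eq_le; apply/andP; split.
    apply: ereal_inf_lbound; exists (eval_form t xs); last by rewrite EF.
    exact: eval_form_feasible.
  by apply: le_ereal_inf_tmp => _ [L feasL <-]; rewrite lee_fin F_ge.
split; first split.
- rewrite fmu; apply/eqP; rewrite eq_le; apply/andP; split.
    apply: ge_ereal_sup => _ [c tpc <-]; rewrite lee_fin.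
    by have := truncated_preordering_ge0 tpc Sxs; rewrite mevalB mevalC subr_ge0.
  apply/lee_addgt0Pr => eps eps0; rewrite -leeBlDr //; apply: ereal_sup_ubound.
  exists (m - eps) => //=; have -> : f - (m - eps)%:MP = f - m%:MP + eps%:MP.
    by rewrite mpolyCB; ring.
  exact: t1P.
- by rewrite fmu fstar.
- by exists xs.
- by exists (eval_form t xs); [exact: eval_form_feasible|rewrite EF fmu].
move=> L optL; have [feasL Lf _] := optL; have Lm : (L F : R) = m.
  by move: Lf; rewrite fmu => -[].
apply/seteqP; split=> p.
  (* Maximality of the rank: the kernel of L lies in that of evaluation at x. *)
  move=> [l l_ker ->] x xmin; rewrite (rmorph_sum (meval x)) big_seq big1 // => u /l_ker[q qker <-].
  have [Sx fx] := xmin; have {}fx : f.@[x] = m by move: fx; rewrite fstar => -[].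
  have : q \in lker (moment_map (eval_form t x)).
    apply: (optimal_ker_sub optL) => //; first exact: eval_form_feasible.
    by rewrite Lm eval_formE.
  move=> /mem_moment_ker/(_ q); rewrite eval_formE /= mevalM => /eqP.
  by rewrite mulf_eq0 orbb => /eqP qx; rewrite mevalM qx mulr0.
move=> pmin; have : generated_ideal [set` G] p by apply: Ggen => x /sminP; exact: pmin.
apply: generated_ideal_sub => h hG.
have [ht hP] := t2P t t2t h hG.
have h_deg : h \in deg_le t by rewrite unfold_in /= leqW.
exists (PolyLe h_deg) => //; set H := PolyLe h_deg.
apply/(moment_ker_sqr H feasL)/eqP.
have Hge : 0 <= (L (polyle_mul H H) : R) by exact: feasible_form_sqr feasL.
rewrite eq_le Hge andbT.
have := @feasible_form_ge0 R n n1 n2 g0 gp t L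
  (C h *: (F + (- m) *: polyle1 n R t) + (- 1) *: polyle_mul H H) feasL.
have -> : (L (C h *: (F + (- m) *: polyle1 n R t) + (- 1) *: polyle_mul H H) : R) =
    - L (polyle_mul H H).
  rewrite formDZ -[X in L X + _]add0r formDZ formDZ feasL.2 Lm linear0.
  by rewrite mulr1 subrr mulr0 !add0r mulN1r.
rewrite oppr_ge0; apply=> eps eps0 /=.
have -> : C h *: (f + - m *: 1) + -1 *: (h * h) = C h *: (f - m%:MP) - h * h.
  by rewrite scaleN1r scaleNr -[m *: 1]mul_mpolyC mulr1.
exact: hP.
Qed.
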